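(* Let $V$ be an optimal prefix-free machine and let $T>0$ be real. Define $\Theta_V(T)=\sum_{s\in\{0,1\}^*,\,H_V(s)<|s|}2^{-|s|/T}$. Then: (i) if $T$ is computable and $0<T\le 1$, then $\Theta_V(T)$ is a left-computable real which is weakly Chaitin $T$-random; (ii) if $T$ is computable and $0<T<1$, then $\Theta_V(T)$ is strictly $T$-compressible; (iii) if $1<T$, then $\Theta_V(T)$ diverges to $\infty$.
   Context: $\{0,1\}^*$ is the set of finite binary strings; $|s|$ is the length of $s$. A prefix-free machine is a partial recursive function $C:\{0,1\}^*\to\{0,1\}^*$ whose domain is prefix-free. $H_C(s)=\min\{|p| : C(p)=s\}$ (possibly $\infty$). A prefix-free machine $U$ is optimal if for every prefix-free machine $C$ there is $d\in\mathbb{N}$ such that for every $p\in\mathrm{Dom}\,C$ there is $q\in\mathrm{Dom}\,U$ with $U(q)=C(p)$ and $|q|\le|p|+d$. A particular optimal prefix-free machine $U$ is fixed and $H(s):=H_U(s)$. For a real $\alpha$ and $n\ge1$, $\alpha\restriction n$ denotes the first $n$ bits of the base-two expansion of $\alpha-\lfloor\alpha\rfloor$ (the expansion with infinitely many zeros). A real $\alpha$ is computable if there is a total recursive $f:\mathbb{N}^+\to\mathbb{Q}$ with $|\alpha-f(n)|<1/n$ for all $n$; right-computable if there is a total recursive $f:\mathbb{N}^+\to\mathbb{Q}$ with $\alpha\le f(n)$ for all $n$ and $f(n)\to\alpha$; left-computable if $-\alpha$ is right-computable. For $T\in(0,1]$, $\alpha$ is weakly Chaitin $T$-random if there is $c\in\mathbb{N}$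 with $Tn-c\le H(\alpha\restriction n)$ for all $n\in\mathbb{N}^+$; $\alpha$ is strictly $T$-compressible if there is $d\in\mathbb{N}$ with $H(\alpha\restriction n)\le Tn+d$ for all $n\in\mathbb{N}^+$. *)

(* Defs.v *)
From Stdlib Require Import Reals Lra Lia Arith List ClassicalEpsilon.
From Coquelicot Require Import Coquelicot.
Import ListNotations.
Open Scope R_scope.

Definition npair (x y : nat) : nat := (Nat.div ((x + y) * S (x + y)) 2 + y)%nat.

(* inverse of npair, enumerating diagonals in the same order *)
Fixpoint nunpair (z : nat) : nat * nat :=
  match z with
  | O => (O, O)
  | S z' => let (x, y) := nunpair z' in
            match x with
            | S x' => (x', S y)
            | O => (S y, O)
            end
  end.

(* ---------- A Turing-complete model: unary mu-recursive functions
   on nat with Cantor pairing (Kleene's basis) ---------- *)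
Inductive code : Type :=
| cZ : code
| cS : code
| cFst : code
| cSnd : code
| cComp : code -> code -> code
| cPair : code -> code -> code
| cPrec : code -> code -> code
| cMin : code -> code.

Inductive eval : code -> nat -> nat -> Prop :=
| eZ x : eval cZ x 0
| eS x : eval cS x (S x)
| eFst x y : eval cFst (npair x y) x
| eSnd x y : eval cSnd (npair x y) y
| eComp f g x y z : eval g x y -> eval f y z -> eval (cComp f g) x z
| ePair f g x y z : eval f x y -> eval g x z -> eval (cPair f g) x (npair y z)
| ePrec0 f g x y : eval f x y -> eval (cPrec f g) (npair x 0) y
| ePrecS f g x n y z :
    eval (cPrec f g) (npair x n) y -> eval g (npair x (npair n y)) z ->
    eval (cPrec f g) (npair x (S n)) z
| eMin f x n :
    eval f (npair x n) 0 ->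
    (forall m, (m < n)%nat -> exists k, eval f (npair x m) (S k)) ->
    eval (cMin f) x n.

Definition bstring := list bool.

(* computable bijection {0,1}^* -> nat (bijective base 2) *)
Fixpoint bcode (s : bstring) : nat :=
  match s with
  | [] => O
  | b :: s' => (2 * bcode s' + 1 + (if b then 1 else 0))%nat
  end.

Definition is_prefix (p q : bstring) : Prop := exists r, q = p ++ r.

(* A (partial recursive) machine C : {0,1}^* -> {0,1}^* is given by a code;
   runs C p s  <->  C(p) is defined and equals s. *)
Definition runs (C : code) (p s : bstring) : Prop := eval C (bcode p) (bcode s).

Definition in_dom (C : code) (p : bstring) : Prop := exists s, runs C p s.

Definition prefix_free (C : code) : Prop :=
  forall p q, in_dom C p -> in_dom C q -> is_prefix p q -> p = q.

Definition optimal (U : code) : Prop :=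
  prefix_free U /\
  forall C : code, prefix_free C ->
    exists d : nat, forall p s, runs C p s ->
      exists q, runs U q s /\ (length q <= length p + d)%nat.

Definition H_lt_length (C : code) (s : bstring) : Prop :=
  exists p, runs C p s /\ (length p < length s)%nat.

(* k-th bit (k >= 1) of alpha - floor alpha, expansion with infinitely many zeros *)
Definition bit (a : R) (k : nat) : bool :=
  Z.odd (Int_part (2 ^ k * (a - IZR (Int_part a)))).

Definition restr (a : R) (n : nat) : bstring := map (fun k => bit a (S k)) (seq 0 n).

Definition zdec (a : nat) : R :=
  if Nat.odd a then - INR (Nat.div (S a) 2) else INR (Nat.div a 2).

(* standard (surjective) decoding of naturals into rationals *)
Definition decQ (y : nat) : R :=
  let (a, b) := nunpair y in zdec a / INR (S b).

Definition total_code (c : code) : Prop := forall n, exists y, eval c n y.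

Definition computable_real (a : R) : Prop :=
  exists c, total_code c /\
    forall n y, (1 <= n)%nat -> eval c n y -> Rabs (a - decQ y) < / INR n.

Definition right_computable (a : R) : Prop :=
  exists c, total_code c /\
    (forall n y, (1 <= n)%nat -> eval c n y -> a <= decQ y) /\
    (forall eps, 0 < eps -> exists N, forall n y, (N <= n)%nat -> (1 <= n)%nat ->
        eval c n y -> Rabs (decQ y - a) < eps).

Definition left_computable (a : R) : Prop := right_computable (- a).

Definition weakly_Chaitin_random (U : code) (T a : R) : Prop :=
  exists c : nat, forall n : nat, (1 <= n)%nat ->
    forall p, runs U p (restr a n) -> T * INR n - INR c <= INR (length p).

Definition strictly_compressible (U : code) (T a : R) : Prop :=
  exists d : nat, forall n : nat, (1 <= n)%nat ->
    exists p, runs U p (restr a n) /\ INR (length p) <= T * INR n + INR d.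

Fixpoint all_strings (k : nat) : list bstring :=
  match k with
  | O => [[]]
  | S k' => map (cons false) (all_strings k') ++ map (cons true) (all_strings k')
  end.

Definition theta_term (V : code) (T : R) (s : bstring) : R :=
  if excluded_middle_informative (H_lt_length V s)
  then Rpower 2 (- INR (length s) / T) else 0.

Definition theta_partial (V : code) (T : R) (N : nat) : R :=
  fold_right Rplus 0
    (map (theta_term V T) (concat (map all_strings (seq 0 N)))).

(* Main.v *)
Require Import Defs.
From Stdlib Require Import Reals Lra Lia Arith List Bool ClassicalEpsilon.
From Coquelicot Require Import Coquelicot.
Import ListNotations.

(** [Theta_V(T)] is approximated from below along an enumeration of the compressible strings,
    so [n] of its bits reveal a stage after which every compressible string still to be
    enumerated has length at least [T n - O(1)]; a string of length about [T n] not enumerated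
    by then is incompressible, which forces the complexity of these bits up to [T n - O(1)].

    For [T < 1], let [Phi_n] be the sum of [min(1, 2^n 2^(-|s|/T))] over the compressible
    strings [s] enumerated so far.  An integer change of [Phi_n] triggers a request for the
    current [n]-bit approximation, with a program of length [T n + O(1)].  The total weight of
    the requests is at most a constant times [sum_n 2^(-T n) (1 + Phi_n)], which is finite
    because [sum_n 2^(-T n) min(1, 2^(n - |s|/T))] is a two-sided geometric series of size
    [O(2^-|s|)] and the weights [2^-|s|] of compressible strings satisfy Kraft's inequality.

    For [T > 1], padding strings with zeros produces, for infinitely many [n], at least
    [2^(n/T)] compressible strings of length [n]. *)

Open Scope nat_scope.

(** * Computable functions *)

(** The cap controls the number of requests: uncapped, the integer part of [2^n Theta] may change
    about [2^n] times, and [2^n] requests of length [T n] weigh [2^((1 - T) n)], which is not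
    summable over [n]. Under the cap a string with [|s| < T n] counts as one unit, however far it
    moves the sum. The two-sided series decays at the rate [min(T, 1 - T)], which is positive only
    for [T < 1].

    Exact comparisons with the real [T] are avoided throughout: [tau n] replaces [T n] up to 3, and
    the terms are replaced by dyadic lower approximations whose errors sum to at most one unit of
    the last bit. The [n] bits are thus known only up to a few units. For the lower bound this
    enlarges a constant; for the upper bound it is absorbed by three lists of requests.

    Two machines occur: [V] defines the sum and [U] measures the bits. A [U]-program for the bits
    becomes the input of a machine that [V] simulates. *)

Definition nfst (z : nat) : nat := fst (nunpair z).
Definition nsnd (z : nat) : nat := snd (nunpair z).

Lemma triangle_succ k : S k * S (S k) / 2 = k * S k / 2 + S k.
Proof.
  replace (S k * S (S k)) with (k * S k + S k * 2) by nia.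
  now rewrite Nat.div_add.
Qed.

Lemma npair_succ_snd x y : npair x (S y) = S (npair (S x) y).
Proof.
  unfold npair. replace (x + S y) with (S (x + y)) by lia.
  replace (S x + y) with (S (x + y)) by lia. lia.
Qed.

Lemma npair_zero_succ y : npair (S y) 0 = S (npair 0 y).
Proof.
  unfold npair. replace (S y + 0) with (S y) by lia.
  rewrite Nat.add_0_l, triangle_succ. lia.
Qed.

Lemma npair_nfst_nsnd z : npair (nfst z) (nsnd z) = z.
Proof.
  unfold nfst, nsnd. induction z as [|z IH]; [reflexivity|].
  cbn [nunpair]. destruct (nunpair z) as [[|x] y]; cbn [fst snd] in *.
  - rewrite npair_zero_succ. now f_equal.
  - rewrite npair_succ_snd. now f_equal.
Qed.

(** Induction on the diagonal [x + y], then on [y]. Each step undoes one step of [nunpair], and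
    [(S x, 0)] leads back to the end [(0, x)] of the previous diagonal. *)
Lemma nunpair_npair x y : nunpair (npair x y) = (x, y).
Proof.
  remember (x + y) as k eqn:E. revert x y E.
  induction k as [k IHk] using lt_wf_ind. intros x y. revert x.
  induction y as [|y IHy]; intros x E.
  - destruct x as [|x]; [reflexivity|].
    rewrite npair_zero_succ. cbn [nunpair].
    rewrite (IHk x) by lia. reflexivity.
  - rewrite npair_succ_snd. cbn [nunpair]. rewrite IHy by lia. reflexivity.
Qed.

Lemma nfst_npair x y : nfst (npair x y) = x.
Proof. unfold nfst. now rewrite nunpair_npair. Qed.

Lemma nsnd_npair x y : nsnd (npair x y) = y.
Proof. unfold nsnd. now rewrite nunpair_npair. Qed.

Lemma npair_inj x y x' y' : npair x y = npair x' y' -> x = x' /\ y = y'.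
Proof.
  intros E. split.
  - now rewrite <- (nfst_npair x y), E, nfst_npair.
  - now rewrite <- (nsnd_npair x y), E, nsnd_npair.
Qed.

Lemma npair_bounds z : nfst z <= z /\ nsnd z <= z.
Proof.
  rewrite <- (npair_nfst_nsnd z) at 2 4.
  generalize (nfst z) (nsnd z); intros x y. unfold npair.
  assert (H : x + y <= (x + y) * S (x + y) / 2).
  { destruct (x + y) as [|k]; [lia|].
    apply Nat.div_le_lower_bound; nia. }
  lia.
Qed.

Definition computable (f : nat -> nat) : Prop := exists c, forall x, eval c x (f x).
Definition computable2 (f : nat -> nat -> nat) : Prop :=
  computable (fun z => f (nfst z) (nsnd z)).

Lemma computable_ext f g : (forall x, f x = g x) -> computable f -> computable g.
Proof. intros E [c H]. exists c. intros x. rewrite <- E. apply H. Qed.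

Lemma computable_compose f g : computable f -> computable g -> computable (fun x => f (g x)).
Proof. intros [c H] [d K]. exists (cComp c d). intros x. eapply eComp; eauto. Qed.

Lemma computable_nfst f : computable f -> computable (fun x => nfst (f x)).
Proof.
  apply (computable_compose nfst). exists cFst. intros z.
  rewrite <- (npair_nfst_nsnd z) at 1. constructor.
Qed.

Lemma computable_nsnd f : computable f -> computable (fun x => nsnd (f x)).
Proof.
  apply (computable_compose nsnd). exists cSnd. intros z.
  rewrite <- (npair_nfst_nsnd z) at 1. constructor.
Qed.

Lemma computable_S f : computable f -> computable (fun x => S (f x)).
Proof. apply (computable_compose S). exists cS. constructor. Qed.

Lemma computable_const n : computable (fun _ => n).
Proof.
  induction n as [|n IH].
  - exists cZ. constructor.
  - now apply computable_S.
Qed.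

Lemma computable_npair f g :
  computable f -> computable g -> computable (fun x => npair (f x) (g x)).
Proof. intros [c H] [d K]. exists (cPair c d). intros x. constructor; auto. Qed.

Lemma computable_id : computable (fun x => x).
Proof.
  apply computable_ext with (fun x => npair (nfst x) (nsnd x)).
  - apply npair_nfst_nsnd.
  - apply computable_npair.
    + exists cFst. intros z. rewrite <- (npair_nfst_nsnd z) at 1. constructor.
    + exists cSnd. intros z. rewrite <- (npair_nfst_nsnd z) at 1. constructor.
Qed.

Lemma computable2_app f a b :
  computable2 f -> computable a -> computable b -> computable (fun x => f (a x) (b x)).
Proof.
  intros Hf Ha Hb.
  apply computable_ext with (fun x => f (nfst (npair (a x) (b x))) (nsnd (npair (a x) (b x)))).
  - intros x. now rewrite nfst_npair, nsnd_npair.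
  - apply (computable_compose _ (fun x => npair (a x) (b x)) Hf).
    now apply computable_npair.
Qed.

(** The arithmetic and the bounded operators below all reduce to this form of primitive
    recursion. *)
Lemma computable_rect (n a : nat -> nat) (g : nat -> nat -> nat -> nat) :
  computable n -> computable a ->
  computable (fun z => g (nfst z) (nfst (nsnd z)) (nsnd (nsnd z))) ->
  computable (fun x => nat_rect (fun _ => nat) (a x) (fun i r => g x i r) (n x)).
Proof.
  intros Hn [ca Ha] [cg Hg].
  apply (computable2_app (fun x m => nat_rect (fun _ => nat) (a x) (fun i r => g x i r) m)
           (fun x => x) n); [|apply computable_id|assumption].
  exists (cPrec ca cg). intros z. rewrite <- (npair_nfst_nsnd z) at 1.
  generalize (nfst z) (nsnd z). intros x m. induction m as [|m IH].
  - now constructor.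
  - eapply ePrecS; [exact IH|]. specialize (Hg (npair x (npair m
      (nat_rect (fun _ => nat) (a x) (fun i r => g x i r) m)))).
    rewrite !nsnd_npair, !nfst_npair in Hg. exact Hg.
Qed.

Fixpoint nsum (n : nat) (f : nat -> nat) : nat :=
  match n with O => 0 | S n' => nsum n' f + f n' end.

Definition bexists (n : nat) (p : nat -> bool) : bool := existsb p (seq 0 n).

(** [bmin n p] is the least [i < n] with [p i], and [n] if there is none. *)
Fixpoint bmin (n : nat) (p : nat -> bool) : nat :=
  match n with
  | O => 0
  | S n' => if bmin n' p <? n' then bmin n' p else if p n' then n' else S n'
  end.

Lemma bmin_spec n p :
  bmin n p <= n /\ (forall i, i < bmin n p -> p i = false) /\
  (bmin n p < n -> p (bmin n p) = true).
Proof.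
  induction n as [|n (IH1 & IH2 & IH3)]; cbn [bmin].
  - repeat split; intros; lia.
  - destruct (Nat.ltb_spec (bmin n p) n) as [H|H].
    + split; [lia|auto].
    + assert (E0 : bmin n p = n) by lia. rewrite E0 in *.
      destruct (p n) eqn:E; (split; [lia|split; [|lia || auto]]).
      * auto.
      * intros i Hi. destruct (Nat.eq_dec i n) as [->|]; [assumption|apply IH2; lia].
Qed.

Lemma bexists_spec n p : bexists n p = true <-> exists i, i < n /\ p i = true.
Proof.
  unfold bexists. rewrite existsb_exists. split; intros [i [H1 H2]]; exists i;
    (split; [|assumption]); apply in_seq in H1 || apply in_seq; lia.
Qed.

Lemma nsum_ext n f g : (forall i, i < n -> f i = g i) -> nsum n f = nsum n g.
Proof.
  induction n as [|n IH]; intros H; cbn; [reflexivity|].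
  rewrite IH, H; auto; intros; apply H; lia.
Qed.

(** Quotients and string lengths will be computed by counting the indices below a threshold. *)
Lemma nsum_indicator n k : nsum n (fun i => Nat.b2n (i <? k)) = Nat.min n k.
Proof.
  induction n as [|n IH]; cbn [nsum]; [reflexivity|].
  rewrite IH. destruct (Nat.ltb_spec n k); cbn [Nat.b2n]; lia.
Qed.

Lemma computable_pred f : computable f -> computable (fun x => Nat.pred (f x)).
Proof.
  apply (computable_compose Nat.pred).
  apply computable_ext with (fun x => nat_rect (fun _ => nat) 0 (fun i r => i) x).
  - intros [|x]; reflexivity.
  - apply (computable_rect (fun x => x) (fun _ => 0) (fun x i r => i)).
    + apply computable_id.
    + apply computable_const.
    + apply computable_nfst, computable_nsnd, computable_id.
Qed.

Lemma computable_add f g : computable f -> computable g -> computable (fun x => f x + g x).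
Proof.
  intros Hf Hg.
  apply computable_ext with (fun x => nat_rect (fun _ => nat) (f x) (fun i r => S r) (g x)).
  - intros x. induction (g x) as [|n IH]; cbn; lia.
  - apply (computable_rect g f (fun x i r => S r)); auto.
    apply computable_S, computable_nsnd, computable_nsnd, computable_id.
Qed.

Lemma computable_sub f g : computable f -> computable g -> computable (fun x => f x - g x).
Proof.
  intros Hf Hg.
  apply computable_ext with (fun x => nat_rect (fun _ => nat) (f x) (fun i r => Nat.pred r) (g x)).
  - intros x. induction (g x) as [|n IH]; cbn; lia.
  - apply (computable_rect g f (fun x i r => Nat.pred r)); auto.
    apply computable_pred, computable_nsnd, computable_nsnd, computable_id.
Qed.

Lemma computable_nsum n f :
  computable n -> computable2 f -> computable (fun x => nsum (n x) (f x)).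
Proof.
  intros Hn Hf.
  apply computable_ext with (fun x => nat_rect (fun _ => nat) 0 (fun i r => r + f x i) (n x)).
  - intros x. induction (n x) as [|m IH]; cbn; lia.
  - apply (computable_rect n (fun _ => 0) (fun x i r => r + f x i)); auto.
    + apply computable_const.
    + apply computable_add.
      * apply computable_nsnd, computable_nsnd, computable_id.
      * apply computable2_app; [assumption|apply computable_nfst, computable_id|].
        apply computable_nfst, computable_nsnd, computable_id.
Qed.

Lemma computable_mul f g : computable f -> computable g -> computable (fun x => f x * g x).
Proof.
  intros Hf Hg.
  apply computable_ext with (fun x => nsum (g x) ((fun x _ => f x) x)).
  - intros x. cbv beta. induction (g x) as [|n IH]; cbn [nsum]; [|rewrite IH]; lia.
  - apply computable_nsum; [assumption|].
    apply (computable_compose f nfst Hf). apply computable_nfst, computable_id.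
Qed.

Lemma computable_pow f g : computable f -> computable g -> computable (fun x => f x ^ g x).
Proof.
  intros Hf Hg.
  apply computable_ext with (fun x => nat_rect (fun _ => nat) 1 (fun i r => f x * r) (g x)).
  - intros x. induction (g x) as [|n IH]; cbn; [reflexivity|]. now rewrite IH.
  - apply (computable_rect g (fun _ => 1) (fun x i r => f x * r)); auto.
    + apply computable_const.
    + apply computable_mul.
      * apply (computable_compose f nfst Hf), computable_nfst, computable_id.
      * apply computable_nsnd, computable_nsnd, computable_id.
Qed.

Lemma computable_leb f g :
  computable f -> computable g -> computable (fun x => Nat.b2n (f x <=? g x)).
Proof.
  intros Hf Hg. apply computable_ext with (fun x => 1 - (f x - g x)).
  - intros x. destruct (Nat.leb_spec (f x) (g x)); cbn [Nat.b2n]; lia.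
  - auto using computable_sub, computable_const.
Qed.

Lemma computable_negb p :
  computable (fun x => Nat.b2n (p x)) -> computable (fun x => Nat.b2n (negb (p x))).
Proof.
  intros H. apply computable_ext with (fun x => 1 - Nat.b2n (p x)).
  - intros x. now destruct (p x).
  - auto using computable_sub, computable_const.
Qed.

Lemma computable_andb p q :
  computable (fun x => Nat.b2n (p x)) -> computable (fun x => Nat.b2n (q x)) ->
  computable (fun x => Nat.b2n (p x && q x)).
Proof.
  intros H K. apply computable_ext with (fun x => Nat.b2n (p x) * Nat.b2n (q x)).
  - intros x. now destruct (p x), (q x).
  - auto using computable_mul.
Qed.

Lemma computable_orb p q :
  computable (fun x => Nat.b2n (p x)) -> computable (fun x => Nat.b2n (q x)) ->
  computable (fun x => Nat.b2n (p x || q x)).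
Proof.
  intros H K. apply computable_ext with (fun x => Nat.b2n (negb (negb (p x) && negb (q x)))).
  - intros x. now destruct (p x), (q x).
  - auto using computable_negb, computable_andb.
Qed.

Lemma computable_ltb f g :
  computable f -> computable g -> computable (fun x => Nat.b2n (f x <? g x)).
Proof. intros Hf Hg. apply (computable_leb (fun x => S (f x)) g); auto using computable_S. Qed.

Lemma computable_eqb f g :
  computable f -> computable g -> computable (fun x => Nat.b2n (f x =? g x)).
Proof.
  intros Hf Hg. apply computable_ext with (fun x => Nat.b2n ((f x <=? g x) && (g x <=? f x))).
  - intros x. destruct (Nat.eqb_spec (f x) (g x)) as [->|H].
    + now rewrite Nat.leb_refl.
    + destruct (Nat.leb_spec (f x) (g x)), (Nat.leb_spec (g x) (f x)); cbn; lia.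
  - auto using computable_andb, computable_leb.
Qed.

Lemma computable_if p f g :
  computable (fun x => Nat.b2n (p x)) -> computable f -> computable g ->
  computable (fun x => if p x then f x else g x).
Proof.
  intros Hp Hf Hg.
  apply computable_ext with (fun x => Nat.b2n (p x) * f x + (1 - Nat.b2n (p x)) * g x).
  - intros x. destruct (p x); cbn [Nat.b2n]; lia.
  - auto 10 using computable_add, computable_mul, computable_sub, computable_const.
Qed.

Lemma computable_bexists n p :
  computable n -> computable2 (fun x i => Nat.b2n (p x i)) ->
  computable (fun x => Nat.b2n (bexists (n x) (p x))).
Proof.
  intros Hn Hp.
  apply computable_ext with (fun x => Nat.b2n (0 <? nsum (n x) (fun i => Nat.b2n (p x i)))).
  - intros x. unfold bexists. induction (n x) as [|m IH]; [reflexivity|].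
    rewrite seq_S, existsb_app. cbn [nsum existsb Nat.add].
    destruct (existsb (p x) (seq 0 m)), (p x m); cbn in *;
      destruct (nsum m _); cbn in *; try lia; try discriminate.
  - apply computable_ltb; [apply computable_const|].
    apply (computable_nsum n (fun x i => Nat.b2n (p x i))); assumption.
Qed.

Lemma computable_bmin n p :
  computable n -> computable2 (fun x i => Nat.b2n (p x i)) ->
  computable (fun x => bmin (n x) (p x)).
Proof.
  intros Hn Hp.
  apply computable_ext with (fun x => nat_rect (fun _ => nat) 0
     (fun i r => if r <? i then r else if p x i then i else S i) (n x)).
  - intros x. induction (n x) as [|m IH]; cbn [nat_rect bmin]; [reflexivity|].
    now rewrite IH.
  - apply (computable_rect n (fun _ => 0)
      (fun x i r => if r <? i then r else if p x i then i else S i)); auto.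
    + apply computable_const.
    + assert (Hi : computable (fun z => nfst (nsnd z)))
        by apply computable_nfst, computable_nsnd, computable_id.
      assert (Hr : computable (fun z => nsnd (nsnd z)))
        by apply computable_nsnd, computable_nsnd, computable_id.
      apply computable_if; [apply computable_ltb|assumption|apply computable_if];
        auto using computable_S.
      apply (computable2_app (fun x i => Nat.b2n (p x i))); auto.
      apply computable_nfst, computable_id.
Qed.

Lemma nsum_count_div a b : 0 < b -> nsum a (fun i => Nat.b2n (S i * b <=? a)) = a / b.
Proof.
  intros Hb. rewrite (nsum_ext _ _ (fun i => Nat.b2n (i <? a / b))).
  - rewrite nsum_indicator. apply Nat.min_r. apply Nat.Div0.div_le_upper_bound. nia.
  - intros i _. f_equal. apply eq_true_iff_eq. rewrite Nat.leb_le, Nat.ltb_lt.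
    split; intros H.
    + apply Nat.div_le_lower_bound; lia.
    + pose proof (Nat.Div0.mul_div_le a b). nia.
Qed.

Lemma computable_div f g : computable f -> computable g -> computable (fun x => f x / g x).
Proof.
  intros Hf Hg.
  (* [Nat.div] returns 0 for a zero divisor, whereas the count would give [f x]. *)
  apply computable_ext with (fun x => if g x =? 0 then 0 else
    nsum (f x) (fun i => Nat.b2n (S i * g x <=? f x))).
  - intros x. destruct (Nat.eqb_spec (g x) 0) as [->|H].
    + reflexivity.
    + apply nsum_count_div; lia.
  - apply computable_if; [|apply computable_const|].
    { apply computable_eqb; auto using computable_const. }
    apply (computable_nsum f (fun x i => Nat.b2n (S i * g x <=? f x))); auto.
    assert (H1 : computable nfst) by apply computable_nfst, computable_id.
    apply computable_leb; [apply computable_mul|].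
    + apply computable_S, computable_nsnd, computable_id.
    + now apply (computable_compose g nfst).
    + now apply (computable_compose f nfst).
Qed.

Lemma computable_odd f : computable f -> computable (fun x => Nat.b2n (Nat.odd (f x))).
Proof.
  intros Hf. apply computable_ext with (fun x => f x - 2 * (f x / 2)).
  - intros x. pose proof (Nat.div2_odd (f x)) as H. rewrite Nat.div2_div in H. lia.
  - auto 10 using computable_sub, computable_mul, computable_div, computable_const.
Qed.

Create HintDb computable.

(** Keeps programs implicit: the outermost operation selects a closure lemma, and the last four
    cases look up an opaque predicate or function among hypotheses and hints. *)
Ltac computability :=
  cbv beta;
  lazymatch goal with
  | |- computable (fun x => x) => exact computable_id
  | |- computable (fun _ => ?c) => exact (computable_const c)
  | |- computable2 ?f => first [assumption | unfold computable2; computability]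
  | |- computable (fun x => S (@?a x)) => apply (computable_S a); computability
  | |- computable (fun x => Nat.pred (@?a x)) => apply (computable_pred a); computability
  | |- computable (fun x => nfst (@?a x)) => apply (computable_nfst a); computability
  | |- computable (fun x => nsnd (@?a x)) => apply (computable_nsnd a); computability
  | |- computable (fun x => npair (@?a x) (@?b x)) => apply (computable_npair a b); computability
  | |- computable (fun x => @?a x + @?b x) => apply (computable_add a b); computability
  | |- computable (fun x => @?a x - @?b x) => apply (computable_sub a b); computability
  | |- computable (fun x => @?a x * @?b x) => apply (computable_mul a b); computability
  | |- computable (fun x => @?a x ^ @?b x) => apply (computable_pow a b); computability
  | |- computable (fun x => @?a x / @?b x) => apply (computable_div a b); computability
  | |- computable (fun x => nsum (@?n x) (@?f x)) =>
      apply (computable_nsum n f); computability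
  | |- computable (fun x => bmin (@?n x) (@?p x)) =>
      apply (computable_bmin n p); computability
  | |- computable (fun x => Nat.b2n (bexists (@?n x) (@?p x))) =>
      apply (computable_bexists n p); computability
  | |- computable (fun x => Nat.b2n (@?a x <=? @?b x)) => apply (computable_leb a b); computability
  | |- computable (fun x => Nat.b2n (@?a x <? @?b x)) => apply (computable_ltb a b); computability
  | |- computable (fun x => Nat.b2n (@?a x =? @?b x)) => apply (computable_eqb a b); computability
  | |- computable (fun x => Nat.b2n (Nat.odd (@?a x))) => apply (computable_odd a); computability
  | |- computable (fun x => Nat.b2n (negb (@?p x))) => apply (computable_negb p); computability
  | |- computable (fun x => Nat.b2n (andb (@?p x) (@?q x))) =>
      apply (computable_andb p q); computability
  | |- computable (fun x => Nat.b2n (orb (@?p x) (@?q x))) =>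
      apply (computable_orb p q); computability
  | |- computable (fun x => if @?p x then @?a x else @?b x) =>
      apply (computable_if p a b); computability
  | |- computable (fun x => Nat.b2n (?p (@?a x) (@?b x))) =>
      apply (computable2_app (fun u v => Nat.b2n (p u v)) a b);
      [solve [eassumption | eauto with computable]|computability|computability]
  | |- computable (fun x => ?f (@?a x) (@?b x)) =>
      apply (computable2_app f a b);
      [solve [eassumption | eauto with computable]|computability|computability]
  | |- computable (fun x => ?f (@?a x)) =>
      apply (computable_compose f a); [solve [eassumption | eauto with computable]|computability]
  | |- computable ?f => solve [eassumption | eauto with computable]
  end.

(** * Step-bounded evaluation of a fixed code *)

Lemma eval_cPrec_inv f g x n z : eval (cPrec f g) (npair x n) z ->
  match n with
  | 0 => eval f x z
  | S m => exists y, eval (cPrec f g) (npair x m) y /\ eval g (npair x (npair m y)) z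
  end.
Proof.
  intros H. inversion H; subst;
    match goal with E : npair _ _ = npair _ _ |- _ => apply npair_inj in E as [-> <-] end;
    eauto.
Qed.

(** [phi x t] is [0] while the computation on [x] has not halted by stage [t], and
    one plus its result afterwards. *)
Definition stages (c : code) (phi : nat -> nat -> nat) : Prop :=
  (forall x t t' y, phi x t = S y -> t <= t' -> phi x t' = S y) /\
  (forall x y, eval c x y <-> exists t, phi x t = S y).

(** Takes the place of a universal machine: as [c] is fixed, induction on it suffices and codes need
    no numbering. Monotonicity in [t] lets the halting stages of subcomputations be merged into
    their sum. *)
Lemma stages_exist (c : code) : exists phi, computable2 phi /\ stages c phi.
Proof.
  induction c as [| | | |f (pf & Cf & Mf & Ef) g (pg & Cg & Mg & Eg)
    |f (pf & Cf & Mf & Ef) g (pg & Cg & Mg & Eg)|f (pf & Cf & Mf & Ef) g (pg & Cg & Mg & Eg)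
    |f (pf & Cf & Mf & Ef)].
  - exists (fun _ _ => 1). split; [computability|split]; [auto|].
    intros x y. split.
    + intros H; inversion H; subst. now exists 0.
    + intros [t [= <-]]. constructor.
  - exists (fun x _ => S (S x)). split; [computability|split]; [auto|].
    intros x y. split.
    + intros H; inversion H; subst. now exists 0.
    + intros [t [= <-]]. constructor.
  - exists (fun x _ => S (nfst x)). split; [computability|split]; [auto|].
    intros x y. split.
    + intros H; inversion H; subst. rewrite nfst_npair. now exists 0.
    + intros [t [= <-]]. rewrite <- (npair_nfst_nsnd x) at 1. constructor.
  - exists (fun x _ => S (nsnd x)). split; [computability|split]; [auto|].
    intros x y. split.
    + intros H; inversion H; subst. rewrite nsnd_npair. now exists 0.
    + intros [t [= <-]]. rewrite <- (npair_nfst_nsnd x) at 1. constructor.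
  - exists (fun x t => if pg x t =? 0 then 0 else pf (Nat.pred (pg x t)) t).
    split; [computability|split].
    + intros x t t' y H Ht. destruct (pg x t) as [|z] eqn:E; cbn in H; [discriminate|].
      rewrite (Mg _ _ _ _ E Ht). cbn. eauto.
    + intros x y. split.
      * intros H; inversion H as [| | | |? ? ? z ? H1 H2| | | |]; subst.
        apply Eg in H1 as [t1 H1]. apply Ef in H2 as [t2 H2]. exists (t1 + t2).
        rewrite (Mg _ _ (t1 + t2) _ H1) by lia. cbn. apply (Mf _ _ _ _ H2); lia.
      * intros [t H]. destruct (pg x t) as [|z] eqn:E; cbn in H; [discriminate|].
        eapply eComp; [apply Eg|apply Ef]; eauto.
  - exists (fun x t => if (pf x t =? 0) || (pg x t =? 0) then 0
                       else S (npair (Nat.pred (pf x t)) (Nat.pred (pg x t)))).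
    split; [computability|split].
    + intros x t t' y H Ht. destruct (pf x t) as [|u] eqn:E; cbn in H; [discriminate|].
      destruct (pg x t) as [|v] eqn:E'; cbn in H; [discriminate|].
      now rewrite (Mg _ _ _ _ E' Ht), (Mf _ _ _ _ E Ht).
    + intros x y. split.
      * intros H; inversion H as [| | | | |? ? ? u v H1 H2| | |]; subst.
        apply Ef in H1 as [t1 H1]. apply Eg in H2 as [t2 H2]. exists (t1 + t2).
        rewrite (Mf _ _ (t1 + t2) _ H1), (Mg _ _ (t1 + t2) _ H2) by lia. reflexivity.
      * intros [t H]. destruct (pf x t) as [|u] eqn:E; cbn in H; [discriminate|].
        destruct (pg x t) as [|v] eqn:E'; cbn in H; [discriminate|].
        injection H as <-. constructor; [apply Ef|apply Eg]; eauto.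
  - pose (step := fun x t i r => if r =? 0 then 0 else pg (npair x (npair i (Nat.pred r))) t).
    pose (it := fun x t n => nat_rect (fun _ => nat) (pf x t) (fun i r => step x t i r) n).
    assert (Mit : forall x n t t' y, it x t n = S y -> t <= t' -> it x t' n = S y).
    { intros x n t t' y H Ht. revert y H. induction n as [|n IH]; cbn; intros y H; [eauto|].
      unfold step in *. fold (it x t n) in H. fold (it x t' n).
      destruct (it x t n) as [|r] eqn:E; cbn in H; [discriminate|].
      rewrite (IH _ eq_refl). cbn. eauto. }
    assert (Eit : forall x n y, eval (cPrec f g) (npair x n) y <-> exists t, it x t n = S y).
    { intros x n. induction n as [|n IH]; intros y; split.
      - intros H. apply eval_cPrec_inv in H. now apply Ef in H.
      - intros H. constructor. now apply Ef.
      - intros H. apply eval_cPrec_inv in H as (r & H1 & H2).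
        apply IH in H1 as [t1 H1]. apply Eg in H2 as [t2 H2]. exists (t1 + t2).
        cbn. fold (it x (t1 + t2) n). rewrite (Mit _ _ _ (t1 + t2) _ H1) by lia.
        unfold step; cbn. apply (Mg _ _ _ _ H2); lia.
      - intros [t H]. cbn in H. fold (it x t n) in H. unfold step in H.
        destruct (it x t n) as [|r] eqn:E; cbn in H; [discriminate|].
        eapply ePrecS; [apply IH|apply Eg]; eauto. }
    exists (fun z t => it (nfst z) t (nsnd z)). split; [|split].
    + apply (computable_rect (fun z => nsnd (nfst z))
        (fun z => pf (nfst (nfst z)) (nsnd z))
        (fun z i r => step (nfst (nfst z)) (nsnd z) i r)); unfold step; computability.
    + intros z. apply Mit.
    + intros z y. rewrite <- Eit, npair_nfst_nsnd. reflexivity.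
  (* A value of [pf] at most 1 means unfinished or halted with 0. Stopping at both keeps the search
     from passing an argument whose value is not yet known to be nonzero. *)
  - pose (N := fun x t => bmin t (fun m => pf (npair x m) t <=? 1)).
    assert (Huniq : forall x t t' n, pf (npair x n) t = 1 ->
      (forall m, m < n -> 2 <= pf (npair x m) t) -> t <= t' -> n < t' -> N x t' = n).
    { intros x t t' n H1 H2 Ht Hn. destruct (bmin_spec t' (fun m => pf (npair x m) t' <=? 1))
        as (_ & B2 & B3). fold (N x t') in B2, B3.
      destruct (lt_eq_lt_dec (N x t') n) as [[L|E]|G]; [|assumption|].
      - specialize (B3 ltac:(lia)). apply Nat.leb_le in B3.
        specialize (H2 _ L). destruct (pf (npair x (N x t')) t) as [|k] eqn:E; [lia|].
        rewrite (Mf _ _ _ _ E Ht) in B3. lia.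
      - specialize (B2 _ G). apply Nat.leb_gt in B2.
        rewrite (Mf _ _ _ _ H1 Ht) in B2. lia. }
    assert (Hlow : forall x t m, m < N x t -> 2 <= pf (npair x m) t).
    { intros x t m Hm. destruct (bmin_spec t (fun m => pf (npair x m) t <=? 1)) as (_ & B2 & _).
      specialize (B2 _ Hm). apply Nat.leb_gt in B2. lia. }
    exists (fun x t => if (N x t <? t) && (pf (npair x (N x t)) t =? 1) then S (N x t) else 0).
    split; [unfold N; computability|split].
    + intros x t t' y H Ht.
      destruct ((N x t <? t) && (pf (npair x (N x t)) t =? 1)) eqn:B; [|discriminate].
      apply andb_true_iff in B as [H0 H1]. apply Nat.ltb_lt in H0. apply Nat.eqb_eq in H1.
      injection H as <-. rewrite (Huniq x t t' (N x t)); auto; [|lia].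
      rewrite (Mf _ _ _ _ H1 Ht).
      now replace (N x t <? t') with true by (symmetry; apply Nat.ltb_lt; lia).
    + intros x n. split.
      * intros H; inversion H as [| | | | | | | |? ? ? H1 H2]; subst.
        assert (Hb : exists b, forall m, m < n -> 2 <= pf (npair x m) b).
        { clear H H1. induction n as [|n IH].
          - exists 0. intros; lia.
          - destruct IH as [b Hb]; [intros; apply H2; lia|].
            destruct (H2 n ltac:(lia)) as [k Hk]. apply Ef in Hk as [t Hk].
            exists (b + t). intros m Hm. destruct (Nat.eq_dec m n) as [->|].
            + rewrite (Mf _ _ (b + t) _ Hk) by lia. lia.
            + specialize (Hb m ltac:(lia)).
              destruct (pf (npair x m) b) as [|k'] eqn:E; [lia|].
              rewrite (Mf _ _ (b + t) _ E) by lia. lia. }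
        destruct Hb as [b Hb]. apply Ef in H1 as [t H1].
        assert (Hm : forall m, m < n -> 2 <= pf (npair x m) (b + t)).
        { intros m Hm. specialize (Hb m Hm).
          destruct (pf (npair x m) b) as [|k'] eqn:E; [lia|].
          rewrite (Mf _ _ (b + t) _ E) by lia. lia. }
        assert (H1' : pf (npair x n) (b + t) = 1) by (apply (Mf _ _ _ _ H1); lia).
        exists (S (b + t + n)). rewrite (Huniq x (b + t) _ n) by (auto; lia).
        rewrite (Mf _ _ _ _ H1') by lia.
        now replace (n <? S (b + t + n)) with true by (symmetry; apply Nat.ltb_lt; lia).
      * intros [t H].
        destruct ((N x t <? t) && (pf (npair x (N x t)) t =? 1)) eqn:B; [|discriminate].
        apply andb_true_iff in B as [H0 H1]. apply Nat.ltb_lt in H0. apply Nat.eqb_eq in H1.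
        injection H as <-. constructor.
        -- apply Ef; eauto.
        -- intros m Hm. specialize (Hlow x t m Hm).
           destruct (pf (npair x m) t) as [|[|k]] eqn:E; [lia|lia|].
           exists k. apply Ef; eauto.
Qed.

(** At a common late stage both results are read off from the same value of [phi], so no induction
    on [eval] is needed. *)
Lemma eval_det c x y y' : eval c x y -> eval c x y' -> y = y'.
Proof.
  destruct (stages_exist c) as (phi & _ & M & E). intros H H'.
  apply E in H as [t H]. apply E in H' as [t' H'].
  assert (K : S y = S y').
  { rewrite <- (M _ _ (t + t') _ H), <- (M _ _ (t + t') _ H') by lia. reflexivity. }
  now injection K.
Qed.

(** [cMin] looks for a zero, hence [1 - p]. The code diverges on inputs without a witness, which is
    how the partial machines below get their domains. *)
Lemma search_code (p : nat -> nat -> bool) :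
  computable2 (fun x n => Nat.b2n (p x n)) ->
  exists c, forall x n,
    eval c x n <-> p x n = true /\ forall m, m < n -> p x m = false.
Proof.
  intros Hp. assert (H : computable2 (fun x n => 1 - Nat.b2n (p x n))).
  { unfold computable2. apply computable_sub; [apply computable_const|exact Hp]. }
  destruct H as [c Hc].
  assert (Hc' : forall x n, eval c (npair x n) (1 - Nat.b2n (p x n))).
  { intros x n. specialize (Hc (npair x n)). now rewrite nfst_npair, nsnd_npair in Hc. }
  exists (cMin c). intros x n. split.
  - intros H. inversion H as [| | | | | | | |? ? ? H1 H2]; subst. split.
    + pose proof (eval_det _ _ _ _ H1 (Hc' x n)) as E. now destruct (p x n).
    + intros m Hm. destruct (H2 m Hm) as [k Hk].
      pose proof (eval_det _ _ _ _ Hk (Hc' x m)) as E. now destruct (p x m).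
  - intros [H1 H2]. constructor.
    + specialize (Hc' x n). now rewrite H1 in Hc'.
    + intros m Hm. exists 0. specialize (Hc' x m). now rewrite (H2 m Hm) in Hc'.
Qed.

Lemma least_witness (p : nat -> bool) n :
  p n = true -> exists m, p m = true /\ forall i, i < m -> p i = false.
Proof.
  intros H. exists (bmin (S n) p).
  destruct (bmin_spec (S n) p) as (H1 & H2 & H3). split; [|assumption].
  apply H3. destruct (Nat.lt_ge_cases (bmin (S n) p) (S n)) as [|G]; [assumption|].
  rewrite (H2 n) in H by lia. discriminate.
Qed.

Lemma computable_search (p : nat -> nat -> bool) :
  computable2 (fun x n => Nat.b2n (p x n)) -> (forall x, exists n, p x n = true) ->
  exists f, computable f /\ forall x, p x (f x) = true.
Proof.
  intros Hp Hex. destruct (search_code p Hp) as [c Hc].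
  assert (H : forall x, exists n, p x n = true /\ eval c x n).
  { intros x. destruct (Hex x) as [n Hn].
    destruct (least_witness _ _ Hn) as (m & H1 & H2). exists m. split; [|apply Hc]; auto. }
  pose (f := fun x => proj1_sig (constructive_indefinite_description _ (H x))).
  assert (Hf : forall x, p x (f x) = true /\ eval c x (f x)).
  { intros x. exact (proj2_sig (constructive_indefinite_description _ (H x))). }
  exists f. split; [exists c|]; intros x; apply Hf.
Qed.

(** * Binary strings *)

(** This is the floor of [log2 (x + 1)]: the strings of length [k] have the codes [2^k - 1] to
    [2^(k+1) - 2]. *)
Definition len (x : nat) : nat := nsum x (fun i => Nat.b2n (2 ^ S i <=? S x)).

Lemma computable_len : computable len.
Proof. unfold len. computability. Qed.

Lemma bcode_bounds s : 2 ^ length s <= S (bcode s) < 2 ^ S (length s).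
Proof.
  induction s as [|b s IH]; cbn [bcode length]; [cbn; lia|].
  rewrite !(Nat.pow_succ_r' 2) in *. destruct b; lia.
Qed.

Lemma len_bcode s : len (bcode s) = length s.
Proof.
  pose proof (bcode_bounds s) as H. pose proof (Nat.pow_gt_lin_r 2 (length s)).
  unfold len. rewrite (nsum_ext _ _ (fun i => Nat.b2n (i <? length s))).
  - rewrite nsum_indicator. apply Nat.min_r. lia.
  - intros i _. f_equal. apply eq_true_iff_eq. rewrite Nat.leb_le, Nat.ltb_lt. split; intros K.
    + assert (L : 2 ^ S i < 2 ^ S (length s)) by lia. apply Nat.pow_lt_mono_r_iff in L; lia.
    + assert (2 ^ S i <= 2 ^ length s) by (apply Nat.pow_le_mono_r; lia). lia.
Qed.

Lemma bcode_inj s t : bcode s = bcode t -> s = t.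
Proof.
  revert t. induction s as [|b s IH]; intros [|c t]; cbn [bcode]; intros E;
    [reflexivity|lia|lia|].
  destruct b, c; try lia; f_equal; apply IH; lia.
Qed.

Lemma bcode_surj x : exists s, bcode s = x.
Proof.
  induction x as [[|x] IH] using lt_wf_ind; [now exists []|].
  destruct (Nat.Even_or_Odd x) as [[k E]|[k E]]; destruct (IH k) as [s Hs]; try lia.
  - exists (false :: s). cbn [bcode]. lia.
  - exists (true :: s). cbn [bcode]. lia.
Qed.

Lemma bcode_snoc s b : bcode (s ++ [b]) = bcode s + 2 ^ length s * (1 + Nat.b2n b).
Proof.
  induction s as [|c s IH]; cbn [bcode app length]; [destruct b; reflexivity|].
  rewrite IH, Nat.pow_succ_r'. destruct c; lia.
Qed.

(** The [n] lowest binary digits of [v], most significant first. *)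
Definition bits (n v : nat) : bstring :=
  map (fun i => Nat.odd (v / 2 ^ (n - 1 - i))) (seq 0 n).

(** The code of [bits n v] in closed form ([bcode_bits]), so that strings never enter a
    computability proof. *)
Definition bits_code (n v : nat) : nat :=
  nsum n (fun i => 2 ^ i * (1 + Nat.b2n (Nat.odd (v / 2 ^ (n - 1 - i))))).

Lemma computable_bits_code : computable2 bits_code.
Proof. unfold bits_code. computability. Qed.

Hint Resolve computable_len computable_bits_code : computable.

Lemma length_bits n v : length (bits n v) = n.
Proof. unfold bits. now rewrite length_map, length_seq. Qed.

Lemma bcode_bits n v : bcode (bits n v) = bits_code n v.
Proof.
  pose (f := fun i => Nat.odd (v / 2 ^ (n - 1 - i))).
  change (bcode (map f (seq 0 n)) = nsum n (fun i => 2 ^ i * (1 + Nat.b2n (f i)))).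
  clearbody f. induction n as [|n IH]; [reflexivity|].
  rewrite seq_S, map_app. cbn [map nsum Nat.add].
  now rewrite bcode_snoc, IH, length_map, length_seq.
Qed.

Lemma bits_S n v : bits (S n) v = bits n (v / 2) ++ [Nat.odd v].
Proof.
  unfold bits. rewrite seq_S, map_app. cbn [map Nat.add]. f_equal.
  - apply map_ext_in. intros i Hi. apply in_seq in Hi.
    rewrite Nat.Div0.div_div. do 2 f_equal.
    replace (S n - 1 - i) with (S (n - 1 - i)) by lia. apply Nat.pow_succ_r'.
  - replace (S n - 1 - n) with 0 by lia. now rewrite Nat.pow_0_r, Nat.div_1_r.
Qed.

Definition val (s : bstring) : nat := fold_left (fun a b => 2 * a + Nat.b2n b) s 0.

Lemma val_snoc s b : val (s ++ [b]) = 2 * val s + Nat.b2n b.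
Proof. unfold val. now rewrite fold_left_app. Qed.

Lemma val_lt s : val s < 2 ^ length s.
Proof.
  induction s as [|b s IH] using rev_ind; [cbn; lia|].
  rewrite val_snoc, length_app, Nat.add_1_r, Nat.pow_succ_r'. destruct b; cbn [Nat.b2n]; lia.
Qed.

Lemma val_app s t : val (s ++ t) = val s * 2 ^ length t + val t.
Proof.
  induction t as [|b t IH] using rev_ind.
  - rewrite app_nil_r. cbn. lia.
  - rewrite app_assoc, !val_snoc, IH, length_app, Nat.add_1_r, Nat.pow_succ_r'. lia.
Qed.

Lemma val_bits n v : v < 2 ^ n -> val (bits n v) = v.
Proof.
  revert v. induction n as [|n IH]; intros v H; [cbn in *; lia|].
  rewrite bits_S, val_snoc, Nat.pow_succ_r' in *.
  rewrite IH by (apply Nat.Div0.div_lt_upper_bound; lia).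
  rewrite <- Nat.div2_div. symmetry. apply Nat.div2_odd.
Qed.

(** Discards the integer part: [v] will be the floor of [2^n * theta], of which [bits n v] keeps
    only the fractional digits. *)
Lemma bits_shift n v k : bits n (v + k * 2 ^ n) = bits n v.
Proof.
  revert v. induction n as [|n IH]; intros v; [reflexivity|].
  rewrite !bits_S, Nat.pow_succ_r'.
  replace (v + k * (2 * 2 ^ n)) with (v + k * 2 ^ n * 2) by lia.
  rewrite Nat.div_add, IH by lia. f_equal. f_equal.
  rewrite Nat.odd_add, (Nat.mul_comm _ 2), Nat.odd_mul. cbn. now destruct (Nat.odd v).
Qed.

(** * Finite sums of reals and Kraft's inequality *)

Close Scope nat_scope.
Open Scope R_scope.

Definition lsum {A} (f : A -> R) (l : list A) : R := fold_right Rplus 0 (map f l).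
Definition rsum (n : nat) (f : nat -> R) : R := lsum f (seq 0 n).

Lemma lsum_app {A} (f : A -> R) l l' : lsum f (l ++ l') = lsum f l + lsum f l'.
Proof. induction l as [|x l IH]; unfold lsum in *; cbn; [lra|]. rewrite IH. lra. Qed.

Lemma lsum_cons {A} (f : A -> R) x l : lsum f (x :: l) = f x + lsum f l.
Proof. reflexivity. Qed.

Lemma lsum_map {A B} (f : B -> R) (g : A -> B) l : lsum f (map g l) = lsum (fun x => f (g x)) l.
Proof. unfold lsum. now rewrite map_map. Qed.

Lemma lsum_le {A} (f g : A -> R) l :
  (forall x, In x l -> f x <= g x) -> lsum f l <= lsum g l.
Proof.
  induction l as [|x l IH]; unfold lsum in *; cbn; intros H; [lra|].
  apply Rplus_le_compat; auto.
Qed.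

Lemma lsum_ext {A} (f g : A -> R) l :
  (forall x, In x l -> f x = g x) -> lsum f l = lsum g l.
Proof. intros H. apply Rle_antisym; apply lsum_le; intros x Hx; rewrite H by auto; lra. Qed.

Lemma lsum_const {A} c (l : list A) : lsum (fun _ => c) l = INR (length l) * c.
Proof.
  induction l as [|x l IH]; [unfold lsum; cbn; lra|].
  change (c + lsum (fun _ => c) l = INR (S (length l)) * c). rewrite IH, S_INR. lra.
Qed.

Lemma lsum_nonneg {A} (f : A -> R) l : (forall x, In x l -> 0 <= f x) -> 0 <= lsum f l.
Proof.
  intros H. apply lsum_le in H. rewrite lsum_const in H. lra.
Qed.

Lemma lsum_scal {A} c (f : A -> R) l : lsum (fun x => c * f x) l = c * lsum f l.
Proof. induction l as [|x l IH]; unfold lsum in *; cbn; [lra|]. rewrite IH. lra. Qed.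

Lemma lsum_plus {A} (f g : A -> R) l : lsum (fun x => f x + g x) l = lsum f l + lsum g l.
Proof. induction l as [|x l IH]; unfold lsum in *; cbn; [lra|]. rewrite IH. lra. Qed.

Lemma lsum_swap {A B} (f : A -> B -> R) l l' :
  lsum (fun x => lsum (f x) l') l = lsum (fun y => lsum (fun x => f x y) l) l'.
Proof.
  induction l as [|x l IH].
  - change (0 = lsum (fun _ => 0) l'). rewrite lsum_const. lra.
  - change (lsum (f x) l' + lsum (fun x => lsum (f x) l') l =
      lsum (fun y => f x y + lsum (fun x => f x y) l) l').
    now rewrite lsum_plus, IH.
Qed.

Lemma lsum_incl {A} (f : A -> R) l l' :
  NoDup l -> incl l l' -> (forall x, In x l' -> 0 <= f x) -> lsum f l <= lsum f l'.
Proof.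
  intros N. revert l'. induction N as [|x l Hx N IH]; intros l' I P.
  - now apply lsum_nonneg.
  - destruct (in_split x l') as (l1 & l2 & ->); [apply I; now left|].
    rewrite lsum_app. change (f x + lsum f l <= lsum f l1 + (f x + lsum f l2)).
    enough (lsum f l <= lsum f (l1 ++ l2)) by (rewrite lsum_app in *; lra).
    apply IH.
    + intros y Hy. assert (In y (l1 ++ x :: l2)) as K by (apply I; now right).
      apply in_app_or in K as [K|[->|K]]; apply in_or_app; auto. contradiction.
    + intros y Hy. apply P. apply in_app_or in Hy as [|]; apply in_or_app; cbn; auto.
Qed.

Lemma rsum_S n f : rsum (S n) f = rsum n f + f n.
Proof. unfold rsum. rewrite seq_S, lsum_app. unfold lsum at 2. cbn. lra. Qed.

Lemma rsum_mono n m f : (forall i, 0 <= f i) -> (n <= m)%nat -> rsum n f <= rsum m f.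
Proof.
  intros H. induction 1 as [|m _ IH]; [lra|]. rewrite rsum_S. specialize (H m). lra.
Qed.

Lemma INR_nsum n f : INR (nsum n f) = rsum n (fun i => INR (f i)).
Proof.
  induction n as [|n IH]; [reflexivity|].
  cbn [nsum]. now rewrite plus_INR, rsum_S, IH.
Qed.

Lemma lsum_list_prod {A B} (g : A -> B -> R) l l' :
  lsum (fun z => g (fst z) (snd z)) (list_prod l l') = lsum (fun a => lsum (g a) l') l.
Proof.
  induction l as [|a l IH]; [reflexivity|].
  cbn [list_prod]. rewrite lsum_app, lsum_map, IH. reflexivity.
Qed.

(** Requests are numbered by pairs. Both components of a pair are at most its code, so the pairs
    with codes below [N] are distinct points of the square of side [N]. *)
Lemma rsum_npair_le N (g : nat -> nat -> R) : (forall a b, 0 <= g a b) ->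
  rsum N (fun i => g (nfst i) (nsnd i)) <= rsum N (fun a => rsum N (g a)).
Proof.
  intros P. unfold rsum.
  apply Rle_trans with (lsum (fun z => g (fst z) (snd z)) (list_prod (seq 0 N) (seq 0 N))).
  - rewrite <- (lsum_map (fun z => g (fst z) (snd z)) nunpair).
    apply lsum_incl; [| |auto].
    + apply NoDup_map_NoDup_ForallPairs; [|apply seq_NoDup].
      intros x y _ _ E. rewrite <- (npair_nfst_nsnd x), <- (npair_nfst_nsnd y).
      unfold nfst, nsnd. now rewrite E.
    + intros z Hz. apply in_map_iff in Hz as (i & <- & Hi). apply in_seq in Hi.
      destruct (npair_bounds i) as [B1 B2]. unfold nfst, nsnd in *.
      destruct (nunpair i) as [a b]. apply in_prod; apply in_seq; cbn in *; lia.
  - apply Req_le, lsum_list_prod.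
Qed.

Lemma half_pow_pos n : 0 < (/ 2) ^ n.
Proof. apply pow_lt. lra. Qed.

Definition tails (b : bool) (l : list bstring) : list bstring :=
  flat_map (fun p => match p with [] => [] | c :: q => if Bool.eqb b c then [q] else [] end) l.

Lemma in_tails b l q : In q (tails b l) <-> In (b :: q) l.
Proof.
  unfold tails. rewrite in_flat_map. split.
  - intros ([|c p] & H1 & H2); [contradiction|].
    destruct (Bool.eqb_spec b c) as [->|]; [|contradiction].
    destruct H2 as [->|[]]. assumption.
  - intros H. exists (b :: q). split; [assumption|]. rewrite Bool.eqb_reflx. now left.
Qed.

Lemma NoDup_tails b l : NoDup l -> NoDup (tails b l).
Proof.
  induction 1 as [|[|c p] l H N IH]; [constructor|assumption|].
  cbn. destruct (Bool.eqb_spec b c) as [->|]; [|assumption].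
  constructor; [|assumption].
  change (~ In p (tails c l)). now rewrite in_tails.
Qed.

Lemma lsum_tails l : ~ In [] l ->
  lsum (fun p : bstring => (/ 2) ^ length p) l =
  / 2 * (lsum (fun p : bstring => (/ 2) ^ length p) (tails false l) +
         lsum (fun p : bstring => (/ 2) ^ length p) (tails true l)).
Proof.
  induction l as [|[|b p] l IH]; intros H.
  - unfold lsum; cbn; lra.
  - exfalso. apply H. now left.
  - specialize (IH (fun K => H (or_intror K))). destruct b.
    + change (tails false ((true :: p) :: l)) with (tails false l).
      change (tails true ((true :: p) :: l)) with (p :: tails true l).
      rewrite !lsum_cons, IH. cbn [length pow]. lra.
    + change (tails false ((false :: p) :: l)) with (p :: tails false l).
      change (tails true ((false :: p) :: l)) with (tails true l).
      rewrite !lsum_cons, IH. cbn [length pow]. lra.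
Qed.

(** Induction on a bound for the lengths. The empty string, if present, is the only member;
    otherwise removing the first bit splits the list into two prefix-free lists of shorter strings,
    each entering with factor 1/2. *)
Lemma kraft_inequality (l : list bstring) : NoDup l ->
  (forall p q, In p l -> In q l -> is_prefix p q -> p = q) ->
  lsum (fun p : bstring => (/ 2) ^ length p) l <= 1.
Proof.
  assert (Hn : exists n, forall p, In p l -> (length p <= n)%nat).
  { exists (list_max (map (@length bool) l)). intros p Hp.
    assert (K := proj1 (list_max_le (map (@length bool) l) _) (le_n _)).
    rewrite Forall_forall in K. apply K. now apply in_map. }
  destruct Hn as [n Hn]. revert l Hn. induction n as [|n IH]; intros l Hn N P;
    (destruct (in_dec (list_eq_dec Bool.bool_dec) [] l) as [H|H];
     [assert (I : incl l [[]]);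
       [intros p Hp; left; apply P; auto; now exists p|
        eapply Rle_trans; [apply (lsum_incl _ _ [[]]); auto; intros; apply Rlt_le, half_pow_pos|
          unfold lsum; cbn; lra]]|]).
  - destruct l as [|p l]; [unfold lsum; cbn; lra|].
    exfalso. apply H. left. specialize (Hn p (or_introl eq_refl)).
    destruct p; [reflexivity|cbn in Hn; lia].
  - rewrite lsum_tails by assumption.
    assert (K : forall b, lsum (fun p : bstring => (/ 2) ^ length p) (tails b l) <= 1).
    { intros b. apply IH.
      - intros p Hp. apply in_tails, Hn in Hp. cbn in Hp. lia.
      - now apply NoDup_tails.
      - intros p q Hp Hq [r ->]. apply in_tails in Hp, Hq.
        assert (E : b :: p = b :: p ++ r) by (apply P; auto; now exists r).
        now injection E. }
    pose proof (K false). pose proof (K true). lra.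
Qed.

Lemma runs_det C p s t : runs C p s -> runs C p t -> s = t.
Proof. intros H K. apply bcode_inj. exact (eval_det _ _ _ _ H K). Qed.

(** The chosen programs are distinct because [V] is single-valued, and they form a prefix-free set.
    Each is at least one bit shorter than its string, which gains the factor 1/2 over Kraft's
    bound. *)
Lemma kraft_compressible V (l : list bstring) : prefix_free V -> NoDup l ->
  (forall s, In s l -> H_lt_length V s) -> lsum (fun s : bstring => (/ 2) ^ length s) l <= / 2.
Proof.
  intros PF N H.
  pose (prog := fun s => epsilon (inhabits []) (fun p => runs V p s /\ (length p < length s)%nat)).
  assert (Hp : forall s, In s l -> runs V (prog s) s /\ (length (prog s) < length s)%nat).
  { intros s Hs. apply epsilon_spec. now apply H. }
  assert (K : lsum (fun p : bstring => (/ 2) ^ length p) (map prog l) <= 1).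
  { apply kraft_inequality.
    - apply NoDup_map_NoDup_ForallPairs; [|assumption].
      intros s t Hs Ht E. apply (runs_det V (prog s)); [|rewrite E]; now apply Hp.
    - intros p q Hpl Hql. apply in_map_iff in Hpl as (s & <- & Hs).
      apply in_map_iff in Hql as (t & <- & Ht).
      apply PF; [exists s|exists t]; now apply Hp. }
  rewrite lsum_map in K.
  apply Rmult_le_reg_l with 2; [lra|]. rewrite <- lsum_scal.
  apply Rle_trans with (2 := Rle_trans _ _ _ K (Req_le _ _ (eq_sym (Rinv_r 2 ltac:(lra))))).
  apply lsum_le. intros s Hs. destruct (Hp s Hs) as [_ L].
  destruct (length s) as [|m]; [lia|].
  replace (2 * (/ 2) ^ S m) with ((/ 2) ^ m) by (cbn; lra).
  rewrite !pow_inv. apply Rinv_le_contravar; [apply pow_lt; lra|].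
  apply Rle_pow; [lra|lia].
Qed.

Lemma pow_2_INR n : INR (2 ^ n) = 2 ^ n.
Proof. now rewrite pow_INR. Qed.

Lemma NoDup_map_bits n m : (m <= 2 ^ n)%nat -> NoDup (map (bits n) (seq 0 m)).
Proof.
  intros Hm. apply NoDup_map_NoDup_ForallPairs; [|apply seq_NoDup].
  intros x y Hx Hy E. apply in_seq in Hx, Hy.
  rewrite <- (val_bits n x), <- (val_bits n y) by lia. now rewrite E.
Qed.

(** Here the bound 1/2 matters: the [2^m] strings of length [m] together weigh 1. *)
Lemma incompressible_exists V m : prefix_free V ->
  exists s, length s = m /\ ~ H_lt_length V s.
Proof.
  intros PF. apply NNPP. intros H.
  assert (K : lsum (fun s : bstring => (/ 2) ^ length s) (map (bits m) (seq 0 (2 ^ m))) <= / 2).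
  { apply (kraft_compressible V); [assumption|now apply NoDup_map_bits|].
    intros s Hs. apply in_map_iff in Hs as (v & <- & _). apply NNPP. intros K.
    apply H. exists (bits m v). now rewrite length_bits. }
  rewrite lsum_map, (lsum_ext _ (fun _ => (/ 2) ^ m)), lsum_const, length_seq, pow_2_INR in K.
  - rewrite <- Rpow_mult_distr, Rinv_r, pow1 in K by lra. lra.
  - intros; now rewrite length_bits.
Qed.

(** * Coding a list of requests *)

(** [lo p] and [hi p] are the ends of the dyadic interval of the reals in [0, 1) whose binary
    expansion starts with [p]. *)
Definition lo (p : bstring) : R := INR (val p) / 2 ^ length p.
Definition hi (p : bstring) : R := (INR (val p) + 1) / 2 ^ length p.

Lemma two_pow_pos n : 0 < 2 ^ n.
Proof. apply pow_lt. lra. Qed.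

Lemma lo_lt_hi p : lo p < hi p.
Proof.
  unfold lo, hi, Rdiv. apply Rmult_lt_compat_r; [apply Rinv_0_lt_compat, two_pow_pos|lra].
Qed.

Lemma prefix_interval p q : is_prefix p q -> lo p <= lo q /\ hi q <= hi p.
Proof.
  intros [r ->]. unfold lo, hi. rewrite val_app, plus_INR, mult_INR, pow_2_INR, length_app, pow_add.
  pose proof (two_pow_pos (length p)). pose proof (two_pow_pos (length r)).
  assert (K : INR (val r) + 1 <= 2 ^ length r).
  { rewrite <- pow_2_INR, <- S_INR. apply le_INR, val_lt. }
  pose proof (pos_INR (val r)).
  split.
  - replace (INR (val p) / 2 ^ length p)
      with (INR (val p) * 2 ^ length r / (2 ^ length p * 2 ^ length r)) by (field; lra).
    apply Rmult_le_compat_r; [apply Rlt_le, Rinv_0_lt_compat; nra|lra].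
  - replace ((INR (val p) + 1) / 2 ^ length p)
      with ((INR (val p) + 1) * 2 ^ length r / (2 ^ length p * 2 ^ length r)) by (field; lra).
    apply Rmult_le_compat_r; [apply Rlt_le, Rinv_0_lt_compat; nra|lra].
Qed.

(** [L i = 0] means that there is no [i]-th request. *)
Definition weight (L : nat -> nat) (i : nat) : R := if (L i =? 0)%nat then 0 else (/ 2) ^ L i.

Lemma weight_nonneg L i : 0 <= weight L i.
Proof. unfold weight. destruct (L i =? 0)%nat; [lra|apply Rlt_le, half_pow_pos]. Qed.

Lemma half_pow_scale l e : (l <= e)%nat -> 2 ^ e * (/ 2) ^ l = 2 ^ (e - l).
Proof.
  intros H. replace e with ((e - l) + l)%nat at 1 by lia.
  rewrite pow_add, Rmult_assoc, <- Rpow_mult_distr, Rinv_r, pow1 by lra. lra.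
Qed.

(** The [i]-th request owns the interval [[w, w + 2^-L i)] where [w] is the total weight of
    the earlier requests; its program is the first string of length [L i + 1] whose dyadic
    interval starts at or after [w], and this dyadic interval lies inside the owned one. *)
Theorem kraft_chaitin (L Y : nat -> nat) : computable L -> computable Y ->
  (forall N, rsum N (weight L) <= 1) ->
  exists C, prefix_free C /\
    forall i s, L i <> 0%nat -> bcode s = Y i -> exists p, runs C p s /\ length p = S (L i).
Proof.
  intros HL HY HK.
  (* A crude common exponent: the sum of the lengths up to [i] bounds each of them, so the weight of
     the earlier requests is the integer [W i] over [2^E i]. *)
  pose (E := fun i => nsum (S i) L).
  pose (W := fun i => nsum i (fun j => if (L j =? 0)%nat then 0%nat else (2 ^ (E i - L j))%nat)).
  assert (HE : computable E) by (unfold E; computability).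
  assert (HW : computable W) by (unfold W; computability).
  assert (HLE : forall i j, (j <= i)%nat -> (L j <= E i)%nat).
  { intros i j Hj. unfold E. induction i as [|i IH]; cbn [nsum] in *.
    - replace j with 0%nat by lia. lia.
    - destruct (Nat.eq_dec j (S i)) as [->|]; [lia|]. specialize (IH ltac:(lia)). lia. }
  assert (HWr : forall i, INR (W i) = 2 ^ E i * rsum i (weight L)).
  { intros i. unfold W, rsum. rewrite INR_nsum, <- lsum_scal. apply lsum_ext.
    intros j Hj. apply in_seq in Hj. unfold weight.
    destruct (L j =? 0)%nat; [cbn; lra|]. rewrite pow_2_INR. symmetry.
    apply half_pow_scale, HLE. lia. }
  (* The witness [w] pairs a request [i] with a number [v]. The last two conditions say, cleared of
     denominators, that [v] is the ceiling of [2^(L i + 1)] times the weight of the earlier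
     requests. *)
  pose (P := fun x w => negb (L (nfst w) =? 0)%nat
    && ((bits_code (S (L (nfst w))) (nsnd w) =? x)%nat
    && ((nsnd w <? 2 ^ S (L (nfst w)))%nat
    && ((W (nfst w) * 2 ^ S (L (nfst w)) <=? nsnd w * 2 ^ E (nfst w))%nat
    && (nsnd w * 2 ^ E (nfst w) <? W (nfst w) * 2 ^ S (L (nfst w)) + 2 ^ E (nfst w))%nat)))).
  assert (HP : computable2 (fun x w => Nat.b2n (P x w))) by (unfold P; computability).
  assert (Pspec : forall p w, P (bcode p) w = true ->
    L (nfst w) <> 0%nat /\ length p = S (L (nfst w)) /\
    rsum (nfst w) (weight L) <= lo p /\ hi p <= rsum (S (nfst w)) (weight L)).
  { intros p w H. unfold P in H. rewrite !andb_true_iff, negb_true_iff in H.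
    destruct H as (H1 & H2 & H3 & H4 & H5).
    apply Nat.eqb_neq in H1. apply Nat.eqb_eq in H2. apply Nat.ltb_lt in H3, H5.
    apply Nat.leb_le in H4. rewrite <- bcode_bits in H2. apply bcode_inj in H2.
    generalize dependent (nsnd w). generalize dependent (nfst w). intros i H1 v Hp H3 H4 H5.
    assert (Hl : length p = S (L i)) by now rewrite <- Hp, length_bits.
    assert (Hv : val p = v) by (rewrite <- Hp; now apply val_bits).
    split; [assumption|split; [assumption|]].
    apply le_INR in H4. apply lt_INR in H5. rewrite plus_INR in H5.
    rewrite !mult_INR, !pow_2_INR, HWr in H4, H5.
    rewrite rsum_S. unfold lo, hi, weight at 3. rewrite Hl, Hv.
    destruct (Nat.eqb_spec (L i) 0) as [|_]; [contradiction|].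
    set (w0 := rsum i (weight L)) in *.
    pose proof (two_pow_pos (E i)) as He. pose proof (two_pow_pos (S (L i))) as Hs.
    assert (A : w0 * 2 ^ S (L i) <= INR v) by nra.
    assert (B : INR v < w0 * 2 ^ S (L i) + 1) by nra.
    assert (D : (/ 2) ^ L i = 2 / 2 ^ S (L i)).
    { rewrite pow_inv. cbn [pow]. field. apply Rgt_not_eq, two_pow_pos. }
    split.
    - apply Rmult_le_reg_r with (1 := Hs). unfold Rdiv. rewrite Rmult_assoc, Rinv_l by lra. lra.
    - rewrite D. replace (w0 + 2 / 2 ^ S (L i))
        with ((w0 * 2 ^ S (L i) + 2) / 2 ^ S (L i)) by (field; lra).
      apply Rmult_le_compat_r; [apply Rlt_le, Rinv_0_lt_compat|]; lra. }
  assert (Puniq : forall p q w w', P (bcode p) w = true -> P (bcode q) w' = true ->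
    is_prefix p q -> nfst w = nfst w').
  { intros p q w w' H H' Hpq. apply Pspec in H as (_ & _ & H1 & H2).
    apply Pspec in H' as (_ & _ & H3 & H4). destruct (prefix_interval _ _ Hpq) as [H5 H6].
    pose proof (lo_lt_hi q) as Hq.
    destruct (lt_eq_lt_dec (nfst w) (nfst w')) as [[G|G]|G]; [|assumption|]; exfalso.
    - pose proof (rsum_mono (S (nfst w)) (nfst w') _ (weight_nonneg L) G). lra.
    - pose proof (rsum_mono (S (nfst w')) (nfst w) _ (weight_nonneg L) G). lra. }
  destruct (search_code P HP) as [c0 Hc0].
  assert (HY' : computable (fun w => Y (nfst w))) by computability.
  destruct HY' as [cY HcY].
  exists (cComp cY c0). split.
  - intros p q [s Hs] [t Ht] Hpq.
    inversion Hs as [| | | |? ? ? w ? A1 A2| | | |]; subst.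
    inversion Ht as [| | | |? ? ? w' ? B1 B2| | | |]; subst.
    apply Hc0 in A1 as [A1 _]. apply Hc0 in B1 as [B1 _].
    pose proof (Puniq _ _ _ _ A1 B1 Hpq) as Ew.
    apply Pspec in A1 as (_ & A1 & _). apply Pspec in B1 as (_ & B1 & _).
    destruct Hpq as [r ->]. rewrite length_app in B1.
    destruct r as [|b r]; [now rewrite app_nil_r|]. cbn in B1. rewrite Ew in A1. lia.
  - intros i s Hi Hs.
    pose (v := ((W i * 2 ^ S (L i) + (2 ^ E i - 1)) / 2 ^ E i)%nat).
    assert (He : (0 < 2 ^ E i)%nat) by (apply Nat.neq_0_lt_0, Nat.pow_nonzero; lia).
    assert (H4 : (W i * 2 ^ S (L i) <= v * 2 ^ E i)%nat).
    { pose proof (Nat.mul_succ_div_gt (W i * 2 ^ S (L i) + (2 ^ E i - 1)) (2 ^ E i)) as K.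
      fold v in K. specialize (K ltac:(lia)). nia. }
    assert (H5 : (v * 2 ^ E i < W i * 2 ^ S (L i) + 2 ^ E i)%nat).
    { pose proof (Nat.Div0.mul_div_le (W i * 2 ^ S (L i) + (2 ^ E i - 1)) (2 ^ E i)) as K.
      fold v in K. nia. }
    (* The total weight is at most 1, so the interval owned by the request ends by 1 and [v] fits
       into [L i + 1] digits. *)
    assert (H3 : (v < 2 ^ S (L i))%nat).
    { apply INR_lt. pose proof H5 as H5'. apply lt_INR in H5'.
      rewrite plus_INR, !mult_INR, !pow_2_INR, HWr in H5'. rewrite pow_2_INR.
      specialize (HK (S i)). rewrite rsum_S in HK. unfold weight at 2 in HK.
      destruct (Nat.eqb_spec (L i) 0) as [|_]; [contradiction|].
      set (w0 := rsum i (weight L)) in *.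
      pose proof (two_pow_pos (E i)) as Pe. pose proof (two_pow_pos (S (L i))) as Ps.
      assert (B : INR v < w0 * 2 ^ S (L i) + 1) by nra.
      assert (D : (/ 2) ^ L i * 2 ^ S (L i) = 2).
      { rewrite Rmult_comm, half_pow_scale by lia. replace (S (L i) - L i)%nat with 1%nat by lia.
        lra. }
      nra. }
    assert (Pv : P (bcode (bits (S (L i)) v)) (npair i v) = true).
    { unfold P. rewrite nfst_npair, nsnd_npair, bcode_bits, Nat.eqb_refl.
      apply Nat.eqb_neq in Hi. apply Nat.ltb_lt in H3, H5. apply Nat.leb_le in H4.
      now rewrite Hi, H3, H4, H5. }
    exists (bits (S (L i)) v). split; [|apply length_bits].
    (* The search may stop at another witness; by [Puniq] it belongs to the same request, and the
       output depends only on the request. *)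
    destruct (least_witness _ _ Pv) as (w & Q1 & Q2).
    assert (Ew : nfst w = i).
    { rewrite <- (nfst_npair i v). apply (Puniq _ _ _ _ Q1 Pv). exists []. now rewrite app_nil_r. }
    unfold runs. eapply eComp; [apply Hc0; split; eassumption|].
    rewrite Hs, <- Ew. apply HcY.
Qed.

Lemma request_complexity (L Y : nat -> nat) U : optimal U -> computable L -> computable Y ->
  (forall N, rsum N (weight L) <= 1) ->
  exists d, forall i s, L i <> 0%nat -> bcode s = Y i ->
    exists p, runs U p s /\ (length p <= L i + d)%nat.
Proof.
  intros [_ HU] HL HY HK. destruct (kraft_chaitin L Y HL HY HK) as (C & PF & HC).
  destruct (HU C PF) as [d Hd]. exists (S d). intros i s Hi Hs.
  destruct (HC i s Hi Hs) as (p & Hp & Lp). destruct (Hd p s Hp) as (q & Hq & Lq).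
  exists q. split; [assumption|lia].
Qed.

(** * Rational approximations *)

Lemma computable_real_fun T : computable_real T ->
  exists g, computable g /\ forall n, (1 <= n)%nat -> Rabs (T - decQ (g n)) < / INR n.
Proof.
  intros (c & Hc & HT).
  pose (g := fun n => proj1_sig (constructive_indefinite_description _ (Hc n))).
  assert (Hg : forall n, eval c n (g n)).
  { intros n. exact (proj2_sig (constructive_indefinite_description _ (Hc n))). }
  exists g. split; [now exists c|]. intros n Hn. apply HT; auto.
Qed.

Lemma INR_div a b : (0 < b)%nat ->
  INR (a / b) <= INR a / INR b < INR (a / b) + 1.
Proof.
  intros Hb. pose proof (Nat.div_mod_eq a b) as E. pose proof (Nat.mod_upper_bound a b) as B.
  assert (0 < INR b) by now apply lt_0_INR.
  split.
  - apply Rle_div_r; [lra|]. rewrite <- mult_INR. apply le_INR. lia.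
  - apply Rlt_div_l; [lra|]. rewrite <- S_INR, <- mult_INR. apply lt_INR. nia.
Qed.

(** Of the slack 3, one unit is the error [n * (1/n)] of the approximation, one is subtracted to
    stay below [n * T], and one is lost by the floor. *)
Lemma computable_multiples T : computable_real T -> 0 < T ->
  exists tau, computable tau /\ forall n, INR (tau n) <= INR n * T < INR (tau n) + 3.
Proof.
  intros HT T0. destruct (computable_real_fun T HT) as (g & Cg & Hg).
  (* An odd numerator code stands for a negative rational; then [n * T < 1], and 0 is a valid
     value. *)
  exists (fun n => if Nat.odd (nfst (g n)) then 0%nat
                   else (n * (nfst (g n) / 2) / S (nsnd (g n)) - 1)%nat).
  split; [computability|]. intros n.
  destruct n as [|n].
  { destruct (Nat.odd _); cbn -[Nat.div]; rewrite ?Nat.Div0.div_0_l; cbn; lra. }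
  specialize (Hg (S n) ltac:(lia)). apply Rabs_def2 in Hg as [H1 H2].
  unfold decQ in H1, H2. unfold nfst, nsnd. destruct (nunpair (g (S n))) as [a b].
  cbn [fst snd]. unfold zdec in H1, H2.
  assert (N0 : 0 < INR (S n)) by (apply lt_0_INR; lia).
  assert (B0 : 0 < INR (S b)) by (apply lt_0_INR; lia).
  set (N := INR (S n)) in *.
  destruct (Nat.odd a).
  - cbn [INR]. split; [nra|].
    assert (Q : 0 <= INR (S a / 2) / INR (S b)).
    { apply Rmult_le_pos; [apply pos_INR|apply Rlt_le, Rinv_0_lt_compat, B0]. }
    assert (E : T < / N).
    { unfold Rdiv in *. rewrite Ropp_mult_distr_l_reverse in H1. lra. }
    apply (Rmult_lt_compat_l N) in E; [|assumption]. rewrite Rinv_r in E by lra. lra.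
  - pose proof (INR_div (S n * (a / 2)) (S b) ltac:(lia)) as [K1 K2].
    rewrite mult_INR in K1, K2. fold N in K1, K2.
    set (r := INR (a / 2) / INR (S b)) in *.
    replace (N * INR (a / 2) / INR (S b)) with (N * r) in K1, K2 by (unfold r; field; lra).
    apply (Rmult_lt_compat_l N) in H1; [|assumption].
    apply (Rmult_lt_compat_l N) in H2; [|assumption].
    replace (N * - / N) with (-1) in H2 by (field; lra).
    rewrite Rinv_r in H1 by lra.
    destruct (S n * (a / 2) / S b)%nat as [|m].
    + cbn [Nat.sub INR] in *. split; nra.
    + replace (S m - 1)%nat with m by lia. rewrite S_INR in K1, K2. split; nra.
Qed.

Lemma pow_lt_mono a x y : (0 < a)%nat -> 0 <= x < y -> x ^ a < y ^ a.
Proof.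
  intros Ha [Hx Hy]. induction a as [|[|a] IH]; [lia|cbn; lra|].
  specialize (IH ltac:(lia)). change (x * x ^ S a < y * y ^ S a).
  assert (0 <= x ^ S a) by now apply pow_le. nra.
Qed.

Lemma pow_le_iff a x y : (0 < a)%nat -> 0 <= x -> 0 <= y -> (x ^ a <= y ^ a <-> x <= y).
Proof.
  intros Ha Hx Hy. split; intros H.
  - apply Rnot_lt_le. intros K. pose proof (pow_lt_mono a y x Ha (conj Hy K)). lra.
  - now apply pow_incr.
Qed.

Lemma Rpower_le_base2 x y : x <= y -> Rpower 2 x <= Rpower 2 y.
Proof. intros H. apply Rle_Rpower; lra. Qed.

Lemma Rpower_pos x y : 0 < Rpower x y.
Proof. apply exp_pos. Qed.

Lemma Rpower_2_INR n : Rpower 2 (INR n) = 2 ^ n.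
Proof. apply Rpower_pow. lra. Qed.

Lemma root_pow D k m a : (0 < a)%nat ->
  (2 ^ D * Rpower 2 (- INR k * (INR m / INR a))) ^ a * 2 ^ (k * m) = 2 ^ (D * a).
Proof.
  intros Ha. assert (0 < INR a) by now apply lt_0_INR.
  rewrite <- !Rpower_2_INR, <- Rpower_plus, <- Rpower_pow, Rpower_mult, <- Rpower_plus
    by apply Rpower_pos.
  f_equal. rewrite !mult_INR. field. lra.
Qed.

(** For the rational exponent [m / a] the bound is decidable: raising to the power [a] leaves
    natural numbers only. *)
Lemma root_le_iff D k m a q : (0 < a)%nat ->
  (q ^ a * 2 ^ (k * m) <= 2 ^ (D * a))%nat <->
  INR q <= 2 ^ D * Rpower 2 (- INR k * (INR m / INR a)).
Proof.
  intros Ha. set (Y := 2 ^ D * Rpower 2 (- INR k * (INR m / INR a))).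
  assert (0 <= Y) by (apply Rmult_le_pos; apply Rlt_le; [apply two_pow_pos|apply Rpower_pos]).
  rewrite <- (pow_le_iff a) by auto using pos_INR.
  pose proof (root_pow D k m a Ha) as E. fold Y in E.
  pose proof (two_pow_pos (k * m)).
  split; intros K.
  - apply le_INR in K. rewrite mult_INR, pow_INR, !pow_2_INR, <- E in K. nra.
  - apply INR_le. rewrite mult_INR, pow_INR, !pow_2_INR, <- E. nra.
Qed.

Lemma is_lim_seq_eventually_gt u l a : is_lim_seq u (Finite l) -> a < l ->
  eventually (fun n => a < u n).
Proof.
  intros H Ha. apply is_lim_seq_spec in H.
  destruct (H (mkposreal (l - a) ltac:(lra))) as [N HN]. exists N. intros n Hn.
  specialize (HN n Hn). apply Rabs_def2 in HN. cbn in HN. lra.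
Qed.

Lemma is_lim_seq_eventually_lt u l a : is_lim_seq u (Finite l) -> l < a ->
  eventually (fun n => u n < a).
Proof.
  intros H Ha. apply is_lim_seq_spec in H.
  destruct (H (mkposreal (a - l) ltac:(lra))) as [N HN]. exists N. intros n Hn.
  specialize (HN n Hn). apply Rabs_def2 in HN. cbn in HN. lra.
Qed.

Lemma is_lim_seq_div_INR c : is_lim_seq (fun n => c / INR n) 0.
Proof.
  replace (Finite 0) with (Rbar_mult c (Rbar_inv p_infty)) by (cbn; f_equal; lra).
  apply is_lim_seq_scal_l. apply is_lim_seq_inv; [apply is_lim_seq_INR|discriminate].
Qed.

(** Where [tau n > 0], the ratios for [e = 0] and [e = 3] enclose [1 / T]; their convergence makes
    the search in [computable_term] succeed. *)
Lemma is_lim_seq_ratio T tau e : 0 < T ->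
  (forall n, INR (tau n) <= INR n * T < INR (tau n) + 3) ->
  is_lim_seq (fun n => INR n / INR (tau n + e)) (/ T).
Proof.
  intros T0 Ht.
  apply is_lim_seq_ext with (fun n => / (INR (tau n + e) / INR n)).
  { intros n. now rewrite Rinv_div. }
  apply (is_lim_seq_inv _ (Finite T)); [|intros [=]; lra].
  apply is_lim_seq_le_le_loc with (fun n => T - 3 / INR n) (fun n => T + INR e / INR n).
  - exists 1%nat. intros n Hn. assert (0 < INR n) by (apply lt_0_INR; lia).
    specialize (Ht n). pose proof (pos_INR e). rewrite plus_INR. split.
    + apply Rle_div_r; [assumption|]. unfold Rdiv.
      rewrite Rmult_minus_distr_r, Rmult_assoc, Rinv_l by lra. lra.
    + apply Rle_div_l; [assumption|]. unfold Rdiv.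
      rewrite Rmult_plus_distr_r, Rmult_assoc, Rinv_l by lra. lra.
  - replace (Finite T) with (Finite (T - 0)) by (f_equal; lra).
    apply is_lim_seq_minus'; [apply is_lim_seq_const|apply is_lim_seq_div_INR].
  - replace (Finite T) with (Finite (T + 0)) by (f_equal; lra).
    apply is_lim_seq_plus'; [apply is_lim_seq_const|apply is_lim_seq_div_INR].
Qed.

Definition term (T : R) (x : nat) : R := Rpower 2 (- INR (len x) / T).

Lemma term_pos T x : 0 < term T x.
Proof. apply Rpower_pos. Qed.

(** The scale turns the error 2 into [2^-x / 2] for [2^n * term T x], so that all errors together
    stay below 1. Windows of width 2 overlap, so one of them has the value strictly inside, and a
    finite precision then certifies it. *)
Lemma computable_term T : computable_real T -> 0 < T ->
  exists Q, computable2 Q /\ forall x n,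
    INR (Q x n) <= 2 ^ (n + x + 2) * term T x < INR (Q x n) + 2.
Proof.
  intros HT T0. destruct (computable_multiples T HT T0) as (tau & Ct & Ht).
  (* [w] pairs a precision [m] with a candidate [q]. As [m / (a + 3) < 1 / T <= m / a], the two
     comparisons certify [q] as a lower and [q + 2] as an upper bound. *)
  pose (p := fun z w => let D := (nsnd z + nfst z + 2)%nat in let k := len (nfst z) in
    let m := nfst w in let a := tau m in let q := nsnd w in
    (0 <? a)%nat && ((q ^ a * 2 ^ (k * m) <=? 2 ^ (D * a))%nat
    && negb ((q + 2) ^ (a + 3) * 2 ^ (k * m) <=? 2 ^ (D * (a + 3)))%nat)).
  destruct (computable_search p) as (f & Cf & Hf).
  - unfold p. cbv zeta. computability.
  - intros z. set (D := (nsnd z + nfst z + 2)%nat). set (k := len (nfst z)).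
    pose (F := fun u => 2 ^ D * Rpower 2 (- INR k * u)).
    assert (Fc : continuity_pt F (/ T)).
    { unfold F, Rpower. reg. }
    assert (F0 : 0 < F (/ T)) by (apply Rmult_lt_0_compat; [apply two_pow_pos|apply Rpower_pos]).
    assert (Hq : exists q, INR q < F (/ T) < INR q + 2).
    { destruct (nfloor_ex (F (/ T))) as [q Hq]; [lra|].
      destruct (Rle_lt_or_eq_dec _ _ (proj1 Hq)) as [K|K].
      - exists q. lra.
      - destruct q as [|q]; [cbn in K; lra|]. exists q. rewrite S_INR in *. lra. }
    destruct Hq as (q & Hq1 & Hq2).
    pose proof (is_lim_seq_continuous _ _ _ Fc (is_lim_seq_ratio T tau 0 T0 Ht)) as L1.
    pose proof (is_lim_seq_continuous _ _ _ Fc (is_lim_seq_ratio T tau 3 T0 Ht)) as L2.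
    destruct (is_lim_seq_eventually_gt _ _ _ L1 Hq1) as [N1 E1].
    destruct (is_lim_seq_eventually_lt _ _ _ L2 Hq2) as [N2 E2].
    destruct (INR_unbounded (3 / T)) as [N3 E3].
    set (m := (N1 + N2 + N3)%nat).
    specialize (E1 m ltac:(lia)). specialize (E2 m ltac:(lia)). 
    assert (E4 : 3 < INR m * T).
    { assert (INR N3 <= INR m) by (apply le_INR; lia).
      apply Rlt_div_l in E3; [nra|assumption]. }
    cbn beta in *. specialize (Ht m).
    assert (Ha : (0 < tau m)%nat) by (apply INR_lt; cbn [INR]; lra).
    exists (npair m q). unfold p. cbv zeta. rewrite nfst_npair, nsnd_npair. fold D k.
    rewrite Nat.add_0_r in E1. unfold F in E1, E2.
    rewrite !andb_true_iff, negb_true_iff, Nat.ltb_lt, Nat.leb_le, Nat.leb_gt.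
    split; [assumption|split].
    + apply root_le_iff; [assumption|lra].
    + apply Nat.nle_gt. rewrite root_le_iff by lia. rewrite plus_INR. cbn [INR]. lra.
  - exists (fun x n => nsnd (f (npair x n))). split; [computability|].
    intros x n. specialize (Hf (npair x n)). unfold p in Hf. cbv zeta in Hf.
    rewrite nfst_npair, nsnd_npair in Hf. generalize dependent (f (npair x n)).
    clear f Cf. intros w. set (m := nfst w). set (q := nsnd w). set (D := (n + x + 2)%nat).
    rewrite !andb_true_iff, negb_true_iff, Nat.ltb_lt, Nat.leb_le, Nat.leb_gt.
    intros (Ha & H1 & H2). apply root_le_iff in H1; [|assumption].
    apply Nat.lt_nge in H2. rewrite root_le_iff in H2 by lia. apply Rnot_le_lt in H2.
    specialize (Ht m). assert (A0 : 0 < INR (tau m)) by now apply lt_0_INR.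
    pose proof (two_pow_pos D). pose proof (pos_INR (len x)).
    rewrite !plus_INR in H2. cbn [INR] in H2. unfold term. split.
    + eapply Rle_trans; [exact H1|]. apply Rmult_le_compat_l; [lra|]. apply Rpower_le_base2.
      enough (/ T <= INR m / INR (tau m)) by nra.
      apply Rle_div_r; [assumption|]. rewrite Rmult_comm. apply Rle_div_l; [assumption|]. lra.
    + eapply Rle_lt_trans; [|apply Rlt_le_trans with (1 := H2); lra].
      apply Rmult_le_compat_l; [lra|]. apply Rpower_le_base2.
      enough (INR m / (INR (tau m) + (1 + 1 + 1)) <= / T) by nra.
      apply Rle_div_l; [lra|]. rewrite Rmult_comm. apply Rle_div_r; [assumption|]. lra.
Qed.

(** * Binary expansions *)

(** [v] may contain the integer part of [a]: removing it from [a] changes the floor of [2^(S i) * a]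
    by an even number, so the parity that defines the bit stays. *)
Lemma restr_bits a n v : INR v <= 2 ^ n * a < INR v + 1 -> restr a n = bits n v.
Proof.
  intros H. unfold restr, bits. apply map_ext_in. intros i Hi. apply in_seq in Hi.
  unfold bit. set (j := (n - 1 - i)%nat). set (K := Int_part a).
  assert (Hw : INR (v / 2 ^ j) <= 2 ^ S i * a < INR (v / 2 ^ j) + 1).
  { replace n with (j + S i)%nat in H by lia. rewrite pow_add, Rmult_assoc in H.
    pose proof (two_pow_pos j) as Pj.
    assert (Hj : (0 < 2 ^ j)%nat) by (apply Nat.neq_0_lt_0, Nat.pow_nonzero; lia).
    pose proof (Nat.Div0.mul_div_le v (2 ^ j)) as H1.
    pose proof (Nat.mul_succ_div_gt v (2 ^ j) ltac:(lia)) as H2.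
    apply le_INR in H1. assert (H3 : (S v <= 2 ^ j * S (v / 2 ^ j))%nat) by lia.
    apply le_INR in H3. rewrite mult_INR, !S_INR, pow_2_INR in H3.
    rewrite mult_INR, pow_2_INR in H1.
    set (w := INR (v / 2 ^ j)) in *. set (b := 2 ^ S i * a) in *. split.
    - apply Rmult_le_reg_l with (1 := Pj). lra.
    - apply Rmult_lt_reg_l with (1 := Pj). lra. }
  assert (Hp : Int_part (2 ^ S i * (a - IZR K)) =
    (Z.of_nat (v / 2 ^ j) - 2 * (2 ^ Z.of_nat i * K))%Z).
  { symmetry. apply Int_part_spec. rewrite minus_IZR, <- INR_IZR_INZ, !mult_IZR, <- pow_IZR.
    cbn [pow] in *. lra. }
  rewrite Hp, Z.odd_sub, Z.odd_mul, Bool.xorb_false_r.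
  generalize (v / 2 ^ j)%nat. intros w. clear.
  destruct (Nat.odd w) eqn:E.
  - apply Nat.odd_spec in E as [k ->]. apply Z.odd_spec. exists (Z.of_nat k). lia.
  - rewrite <- Nat.negb_even in E. apply negb_false_iff, Nat.even_spec in E as [k ->].
    rewrite <- Z.negb_even. apply negb_false_iff, Z.even_spec. exists (Z.of_nat k). lia.
Qed.

(** * The sum over compressible strings *)

Lemma is_lim_seq_bounded_monotone u M : (forall n, u n <= u (S n)) -> (forall n, u n <= M) ->
  exists l, is_lim_seq u (Finite l) /\ forall n, u n <= l.
Proof.
  intros Hi Hb. destruct (ex_finite_lim_seq_incr u M Hi Hb) as [l Hl]. exists l.
  split; [assumption|]. intros n. now apply (is_lim_seq_incr_compare u l).
Qed.

Definition comp (V : code) (x : nat) : Prop := exists s, bcode s = x /\ H_lt_length V s.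

Lemma comp_bcode V s : comp V (bcode s) <-> H_lt_length V s.
Proof.
  split; [|now exists s]. intros (t & E & H). apply bcode_inj in E. now subst.
Qed.

(** The conjunct [x < t] ensures that a sum over [x < t] sees everything found by stage [t]. *)
Lemma H_lt_length_enumerable V : exists found : nat -> nat -> bool,
  computable2 (fun x t => Nat.b2n (found x t)) /\
  (forall x t t', found x t = true -> (t <= t')%nat -> found x t' = true) /\
  (forall x t, found x t = true -> (x < t)%nat) /\
  (forall x, comp V x <-> exists t, found x t = true).
Proof.
  destruct (stages_exist V) as (phi & Cp & Mp & Ep).
  exists (fun x t => (x <? t)%nat &&
    bexists t (fun p => (len p <? len x)%nat && (phi p t =? S x)%nat)).
  split; [computability|].
  assert (F : forall x t, (x <? t)%nat &&
    bexists t (fun p => (len p <? len x)%nat && (phi p t =? S x)%nat) = true <->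
    (x < t)%nat /\ exists p, (p < t)%nat /\ (len p < len x)%nat /\ phi p t = S x).
  { intros x t. rewrite andb_true_iff, bexists_spec, Nat.ltb_lt.
    setoid_rewrite andb_true_iff. setoid_rewrite Nat.ltb_lt. setoid_rewrite Nat.eqb_eq.
    reflexivity. }
  split; [|split].
  - intros x t t' H Ht. apply F in H as (H1 & p & H2 & H3 & H4). apply F.
    split; [lia|]. exists p. repeat split; [lia|assumption|]. eapply Mp; eauto.
  - intros x t H. apply F in H. tauto.
  - intros x. split.
    + intros (s & <- & p & Hp & Lp). apply Ep in Hp as [t Ht].
      exists (S (t + bcode s + bcode p)). apply F. split; [lia|].
      exists (bcode p). rewrite !len_bcode. repeat split; [lia|assumption|].
      eapply Mp; [eassumption|lia].
    + intros [t H]. apply F in H as (H1 & p & H2 & H3 & H4).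
      destruct (bcode_surj x) as [s Hs]. destruct (bcode_surj p) as [p' Hp]. subst.
      rewrite !len_bcode in H3. exists s. split; [reflexivity|]. exists p'.
      split; [|assumption]. apply Ep. eauto.
Qed.

Definition cterm (V : code) (T : R) (x : nat) : R :=
  if excluded_middle_informative (comp V x) then term T x else 0.

Lemma cterm_nonneg V T x : 0 <= cterm V T x.
Proof. unfold cterm. destruct excluded_middle_informative; [apply Rlt_le, term_pos|lra]. Qed.

Lemma theta_term_cterm V T s : theta_term V T s = cterm V T (bcode s).
Proof.
  unfold theta_term, cterm, term. rewrite len_bcode.
  destruct (excluded_middle_informative (H_lt_length V s)) as [H|H];
    destruct (excluded_middle_informative (comp V (bcode s))) as [K|K];
    rewrite comp_bcode in K; tauto.
Qed.

Lemma in_all_strings n s : In s (all_strings n) <-> length s = n.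
Proof.
  revert s. induction n as [|n IH]; intros s; cbn [all_strings].
  - split; [intros [<-|[]]; reflexivity|]. intros H. left. now destruct s.
  - rewrite in_app_iff, !in_map_iff. split.
    + intros [(t & <- & H)|(t & <- & H)]; apply IH in H; cbn; now rewrite H.
    + destruct s as [|b s]; [discriminate|]. intros [= H]. apply IH in H.
      destruct b; [right|left]; now exists s.
Qed.

Lemma NoDup_all_strings n : NoDup (all_strings n).
Proof.
  induction n as [|n IH]; cbn [all_strings]; [repeat constructor; auto|].
  apply NoDup_app.
  - apply NoDup_map_NoDup_ForallPairs; [intros x y _ _ [= E]; exact E|assumption].
  - apply NoDup_map_NoDup_ForallPairs; [intros x y _ _ [= E]; exact E|assumption].
  - intros s H K. apply in_map_iff in H as (u & <- & _). apply in_map_iff in K as (v & [=] & _).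
Qed.

Definition strings_below (N : nat) : list bstring := concat (map all_strings (seq 0 N)).

Lemma strings_below_S N : strings_below (S N) = strings_below N ++ all_strings N.
Proof.
  unfold strings_below. rewrite seq_S, map_app, concat_app. cbn. now rewrite app_nil_r.
Qed.

Lemma in_strings_below N s : In s (strings_below N) <-> (length s < N)%nat.
Proof.
  induction N as [|N IH]; [cbn; lia|].
  rewrite strings_below_S, in_app_iff, IH, in_all_strings. lia.
Qed.

Lemma NoDup_strings_below N : NoDup (strings_below N).
Proof.
  induction N as [|N IH]; [constructor|].
  rewrite strings_below_S. apply NoDup_app; [assumption|apply NoDup_all_strings|].
  intros s H K. apply in_strings_below in H. apply in_all_strings in K. lia.
Qed.

Lemma theta_partial_lsum V T N : theta_partial V T N = lsum (theta_term V T) (strings_below N).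
Proof. reflexivity. Qed.

Lemma theta_term_nonneg V T s : 0 <= theta_term V T s.
Proof. rewrite theta_term_cterm. apply cterm_nonneg. Qed.

Lemma theta_partial_S V T N :
  theta_partial V T (S N) = theta_partial V T N + lsum (theta_term V T) (all_strings N).
Proof. now rewrite !theta_partial_lsum, strings_below_S, lsum_app. Qed.

Lemma theta_partial_mono V T N M : (N <= M)%nat -> theta_partial V T N <= theta_partial V T M.
Proof.
  induction 1 as [|M _ IH]; [lra|]. rewrite theta_partial_S.
  pose proof (lsum_nonneg (theta_term V T) (all_strings M) (fun s _ => theta_term_nonneg V T s)).
  lra.
Qed.

(** With the next lemma this replaces summation by length with summation by code: a code below [t]
    has length below [t], and a string shorter than [N] has a code below [2^N]. *)
Lemma rsum_cterm_le_theta V T t : rsum t (cterm V T) <= theta_partial V T t.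
Proof.
  rewrite theta_partial_lsum, (lsum_ext _ (fun s => cterm V T (bcode s)))
    by (intros; apply theta_term_cterm).
  rewrite <- lsum_map. apply lsum_incl; [apply seq_NoDup| |intros; apply cterm_nonneg].
  intros x Hx. apply in_seq in Hx. destruct (bcode_surj x) as [s <-].
  apply in_map, in_strings_below. pose proof (bcode_bounds s).
  pose proof (Nat.pow_gt_lin_r 2 (length s)). lia.
Qed.

Lemma theta_le_rsum_cterm V T N : theta_partial V T N <= rsum (2 ^ N) (cterm V T).
Proof.
  rewrite theta_partial_lsum, (lsum_ext _ (fun s => cterm V T (bcode s)))
    by (intros; apply theta_term_cterm).
  rewrite <- lsum_map. apply lsum_incl; [| |intros; apply cterm_nonneg].
  - apply NoDup_map_NoDup_ForallPairs; [|apply NoDup_strings_below].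
    intros s t _ _. apply bcode_inj.
  - intros x Hx. apply in_map_iff in Hx as (s & <- & Hs). apply in_strings_below in Hs.
    apply in_seq. pose proof (bcode_bounds s).
    assert (2 ^ S (length s) <= 2 ^ N)%nat by (apply Nat.pow_le_mono_r; lia). lia.
Qed.

Lemma rsum_half_len_le V t : prefix_free V ->
  rsum t (fun x => if excluded_middle_informative (comp V x) then (/ 2) ^ len x else 0) <= 1.
Proof.
  intros PF.
  pose (l := filter (fun s => if excluded_middle_informative (H_lt_length V s) then true else false)
               (strings_below t)).
  assert (K : lsum (fun s : bstring => (/ 2) ^ length s) l <= / 2).
  { apply (kraft_compressible V); [assumption|apply NoDup_filter, NoDup_strings_below|].
    intros s Hs. apply filter_In in Hs as [_ Hs]. now destruct excluded_middle_informative. }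
  set (f := fun x => if excluded_middle_informative (comp V x) then (/ 2) ^ len x else 0).
  assert (Hf : forall x, 0 <= f x).
  { intros x. unfold f. destruct excluded_middle_informative; [apply Rlt_le, half_pow_pos|lra]. }
  apply Rle_trans with (lsum f (map bcode (strings_below t))).
  - apply lsum_incl; [apply seq_NoDup| |auto].
    intros x Hx. apply in_seq in Hx. destruct (bcode_surj x) as [s <-].
    apply in_map, in_strings_below. pose proof (bcode_bounds s).
    pose proof (Nat.pow_gt_lin_r 2 (length s)). lia.
  - apply Rle_trans with (/ 2); [|lra]. apply Rle_trans with (2 := K).
    rewrite lsum_map. unfold l. clear. induction (strings_below t) as [|s l IH]; [apply Rle_refl|].
    rewrite lsum_cons. cbn [filter]. unfold f at 1. rewrite len_bcode.
    destruct (excluded_middle_informative (H_lt_length V s)) as [H|H];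
      destruct (excluded_middle_informative (comp V (bcode s))) as [K|K];
      rewrite comp_bcode in K; try tauto.
    + rewrite lsum_cons. lra.
    + lra.
Qed.

Lemma term_le_half_pow T x : 0 < T <= 1 -> term T x <= (/ 2) ^ len x.
Proof.
  intros HT. unfold term. rewrite pow_inv, <- Rpower_2_INR, <- Rpower_Ropp.
  apply Rpower_le_base2. pose proof (pos_INR (len x)). unfold Rdiv.
  assert (1 <= / T) by (rewrite <- Rinv_1; apply Rinv_le_contravar; lra). nra.
Qed.

(** For [T <= 1] every term is at most [2^-|s|], so Kraft's inequality bounds the sum. The last two
    clauses characterise [theta] by sums over codes, the form used from here on. *)
Lemma theta_converges V T : prefix_free V -> 0 < T <= 1 ->
  exists theta, is_lim_seq (theta_partial V T) (Finite theta) /\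
    (forall t, rsum t (cterm V T) <= theta) /\
    (forall eps, 0 < eps -> exists t, theta - eps < rsum t (cterm V T)).
Proof.
  intros PF HT.
  destruct (is_lim_seq_bounded_monotone (theta_partial V T) 1) as (theta & L & B).
  - intros n. apply theta_partial_mono. lia.
  - intros n. eapply Rle_trans; [apply theta_le_rsum_cterm|].
    eapply Rle_trans; [|apply (rsum_half_len_le V (2 ^ n)); auto].
    apply lsum_le. intros x _. unfold cterm.
    destruct excluded_middle_informative; [now apply term_le_half_pow|lra].
  - exists theta. split; [assumption|split].
    + intros t. eapply Rle_trans; [apply rsum_cterm_le_theta|apply B].
    + intros eps He.
      destruct (is_lim_seq_eventually_gt _ _ (theta - eps) L ltac:(lra)) as [N HN].
      exists (2 ^ N)%nat. eapply Rlt_le_trans; [apply (HN N); lia|apply theta_le_rsum_cterm].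
Qed.

Lemma rsum_eq_0 t f : (forall i, (i < t)%nat -> f i = 0) -> rsum t f = 0.
Proof.
  intros H. unfold rsum. rewrite (lsum_ext _ (fun _ => 0)), lsum_const; [lra|].
  intros x Hx. apply in_seq in Hx. apply H. lia.
Qed.

Lemma rsum_extend t M f : (t <= M)%nat -> (forall i, (t <= i)%nat -> f i = 0) ->
  rsum M f = rsum t f.
Proof.
  intros H Z. induction H as [|M H IH]; [reflexivity|].
  rewrite rsum_S, IH, Z by assumption. lra.
Qed.

Lemma rsum_le n f g : (forall i, (i < n)%nat -> f i <= g i) -> rsum n f <= rsum n g.
Proof. intros H. apply lsum_le. intros i Hi. apply in_seq in Hi. apply H. lia. Qed.

Lemma rsum_half_pow n c : rsum n (fun x => c * (/ 2) ^ x) = c * (2 - 2 * (/ 2) ^ n).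
Proof.
  induction n as [|n IH]; [unfold rsum, lsum; cbn; lra|]. rewrite rsum_S, IH. cbn [pow]. lra.
Qed.

(** * Stagewise approximation from below and left-computability *)

Section Enumeration.

Context (V : code) (T theta : R) (found : nat -> nat -> bool) (Q : nat -> nat -> nat).

Context (found_mono : forall x t t', found x t = true -> (t <= t')%nat -> found x t' = true).
Context (found_lt : forall x t, found x t = true -> (x < t)%nat).
Context (found_comp : forall x, comp V x <-> exists t, found x t = true).
Context (theta_ub : forall t, rsum t (cterm V T) <= theta).
Context (theta_lub : forall eps, 0 < eps -> exists t, theta - eps < rsum t (cterm V T)).
Context (Q_approx : forall x n,
  INR (Q x n) <= 2 ^ (n + x + 2) * term T x < INR (Q x n) + 2).

Definition stage_sum (t : nat) : R := rsum t (fun x => if found x t then term T x else 0).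

Lemma found_cterm x t : found x t = true -> cterm V T x = term T x.
Proof.
  intros H. unfold cterm. destruct excluded_middle_informative as [|K]; [reflexivity|].
  exfalso. apply K, found_comp. eauto.
Qed.

Lemma stage_sum_ext t M : (t <= M)%nat ->
  rsum M (fun x => if found x t then term T x else 0) = stage_sum t.
Proof.
  intros H. apply rsum_extend; [assumption|]. intros x Hx.
  destruct (found x t) eqn:E; [|reflexivity]. apply found_lt in E. lia.
Qed.

Lemma stage_sum_le t : stage_sum t <= theta.
Proof.
  eapply Rle_trans; [|apply (theta_ub t)]. apply lsum_le. intros x _.
  destruct (found x t) eqn:E; [now rewrite (found_cterm _ _ E); lra|apply cterm_nonneg].
Qed.

(** The whole term of [y] is still missing from the stage. Hence a stage close to [theta] has found
    every compressible string with a large term. *)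
Lemma stage_sum_unfound t y : comp V y -> found y t = false -> stage_sum t + term T y <= theta.
Proof.
  intros Hy F. set (M := (t + S y)%nat).
  rewrite <- (stage_sum_ext t M) by lia.
  apply Rle_trans with (2 := theta_ub M).
  assert (K : term T y = rsum M (fun x => if (x =? y)%nat then term T x else 0)).
  { rewrite (rsum_extend (S y) M); [|lia|].
    - rewrite rsum_S, Nat.eqb_refl, rsum_eq_0; [lra|].
      intros i Hi. destruct (Nat.eqb_spec i y); [lia|reflexivity].
    - intros i Hi. destruct (Nat.eqb_spec i y); [lia|reflexivity]. }
  rewrite K. unfold rsum. rewrite <- lsum_plus. apply lsum_le. intros x _.
  destruct (Nat.eqb_spec x y) as [->|].
  - rewrite F. unfold cterm. destruct excluded_middle_informative; [lra|contradiction].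
  - destruct (found x t) eqn:E; [rewrite (found_cterm _ _ E); lra|].
    pose proof (cterm_nonneg V T x). lra.
Qed.

Lemma found_eventually X : exists t0, forall x, (x < X)%nat -> comp V x -> found x t0 = true.
Proof.
  induction X as [|X [t0 IH]]; [exists 0%nat; intros; lia|].
  destruct (classic (comp V X)) as [H|H].
  - apply found_comp in H as [t1 H]. exists (t0 + t1)%nat. intros x Hx Cx.
    destruct (Nat.eq_dec x X) as [->|].
    + apply (found_mono _ _ _ H). lia.
    + apply (found_mono x t0); [apply IH; [lia|assumption]|lia].
  - exists t0. intros x Hx Cx. destruct (Nat.eq_dec x X) as [->|]; [contradiction|].
    apply IH; [lia|assumption].
Qed.

Lemma stage_sum_lim eps : 0 < eps ->
  exists t0, forall t, (t0 <= t)%nat -> theta - eps < stage_sum t.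
Proof.
  intros He. destruct (theta_lub eps He) as [X HX]. destruct (found_eventually X) as [t0 H0].
  exists (t0 + X)%nat. intros t Ht. apply Rlt_le_trans with (1 := HX).
  apply Rle_trans with (rsum X (fun x => if found x t then term T x else 0)).
  - apply rsum_le. intros x Hx. unfold cterm.
    destruct excluded_middle_informative as [C|C].
    + rewrite (found_mono x t0 t); [lra|now apply H0|lia].
    + destruct (found x t); [apply Rlt_le, term_pos|lra].
  - apply rsum_mono; [|lia]. intros x. destruct (found x t); [apply Rlt_le, term_pos|lra].
Qed.

(** Approximates [2^n * term T x] from below, so that errors are measured in units of the [n]-th
    bit. *)
Definition qterm (x n : nat) : R := INR (Q x n) / 2 ^ (x + 2).

Lemma qterm_nonneg x n : 0 <= qterm x n.
Proof.
  apply Rmult_le_pos; [apply pos_INR|apply Rlt_le, Rinv_0_lt_compat, two_pow_pos].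
Qed.

Lemma qterm_approx x n : qterm x n <= 2 ^ n * term T x <= qterm x n + / 2 * (/ 2) ^ x.
Proof.
  destruct (Q_approx x n) as [H1 H2]. unfold qterm.
  replace (n + x + 2)%nat with (n + (x + 2))%nat in * by lia. rewrite pow_add in H1, H2.
  pose proof (two_pow_pos (x + 2)) as P. split.
  - apply Rle_div_l; [assumption|]. lra.
  - replace (/ 2 * (/ 2) ^ x) with (2 / 2 ^ (x + 2)).
    + replace (INR (Q x n) / 2 ^ (x + 2) + 2 / 2 ^ (x + 2))
        with ((INR (Q x n) + 2) / 2 ^ (x + 2)) by (field; lra).
      apply (Rle_div_r _ _ (2 ^ (x + 2))); [assumption|]. lra.
    + rewrite pow_add, pow_inv. cbn [pow]. field. apply Rgt_not_eq, two_pow_pos.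
Qed.

Definition approx_sum (n t : nat) : R := rsum t (fun x => if found x t then qterm x n else 0).

Lemma approx_sum_le n t : approx_sum n t <= 2 ^ n * stage_sum t.
Proof.
  unfold approx_sum, stage_sum, rsum. rewrite <- lsum_scal. apply lsum_le. intros x _.
  destruct (found x t); [apply qterm_approx|lra].
Qed.

(** The rounding errors are at most [2^-x / 2], a geometric series with sum 1. *)
Lemma approx_sum_ge n t : 2 ^ n * stage_sum t - 1 <= approx_sum n t.
Proof.
  assert (K : 2 ^ n * stage_sum t <= approx_sum n t + rsum t (fun x => / 2 * (/ 2) ^ x)).
  { unfold approx_sum, stage_sum, rsum. rewrite <- lsum_scal, <- lsum_plus. apply lsum_le.
    intros x _. destruct (found x t); [apply qterm_approx|].
    pose proof (half_pow_pos x). lra. }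
  rewrite rsum_half_pow in K. pose proof (half_pow_pos t). lra.
Qed.

Lemma approx_sum_le_theta n t : approx_sum n t <= 2 ^ n * theta.
Proof.
  eapply Rle_trans; [apply approx_sum_le|].
  apply Rmult_le_compat_l; [apply Rlt_le, two_pow_pos|apply stage_sum_le].
Qed.

Definition approx_num (n t : nat) : nat :=
  nsum t (fun x => if found x t then (Q x n * 2 ^ (t - x))%nat else 0%nat).

Lemma INR_approx_num n t : INR (approx_num n t) = approx_sum n t * 2 ^ (t + 2).
Proof.
  unfold approx_num, approx_sum. rewrite INR_nsum, (Rmult_comm _ (2 ^ (t + 2))).
  unfold rsum. rewrite <- lsum_scal. apply lsum_ext. intros x Hx. apply in_seq in Hx.
  destruct (found x t); [|cbn; lra]. rewrite mult_INR, pow_2_INR. unfold qterm.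
  replace (t + 2)%nat with ((t - x) + (x + 2))%nat by lia. rewrite pow_add. field.
  apply Rgt_not_eq, two_pow_pos.
Qed.

Lemma computable_approx_num : computable2 Q -> computable2 (fun x t => Nat.b2n (found x t)) ->
  computable2 approx_num.
Proof. intros HQ Hf. unfold approx_num. computability. Qed.

Context (Q_computable : computable2 Q).
Context (found_computable : computable2 (fun x t => Nat.b2n (found x t))).

(** The odd number [2 a - 1] codes [- a]; for [a = 0] truncated subtraction yields 0, the code of
    zero. *)
Lemma decQ_npair_neg a b : (0 < b)%nat ->
  decQ (npair (2 * a - 1) (b - 1)) = - (INR a / INR b).
Proof.
  intros Hb. unfold decQ. rewrite nunpair_npair. replace (S (b - 1)) with b by lia.
  unfold zdec. destruct a as [|a]; [cbn; lra|].
  replace (2 * S a - 1)%nat with (S (2 * a)) by lia.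
  rewrite Nat.odd_succ, Nat.even_mul. cbn [Nat.even orb].
  replace (S (S (2 * a))) with (S a * 2)%nat by lia. rewrite Nat.div_mul by lia. lra.
Qed.

(** The diagonal [approx_sum n n / 2^n] serves: it never exceeds [theta] and falls short of
    [stage_sum n] by at most [2^-n]. *)
Lemma theta_left_computable : left_computable theta.
Proof.
  pose proof (computable_approx_num Q_computable found_computable) as Ca.
  assert (Cf : computable (fun n => npair (2 * approx_num n n - 1) (2 ^ (n + (n + 2)) - 1)))
    by computability.
  destruct Cf as [c Hc].
  assert (Hv : forall n y, eval c n y -> decQ y = - (approx_sum n n / 2 ^ n)).
  { intros n y Hy. rewrite (eval_det _ _ _ _ Hy (Hc n)), decQ_npair_neg.
    - rewrite pow_2_INR, INR_approx_num, (pow_add 2 n (n + 2)). f_equal. field.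
      split; apply Rgt_not_eq, two_pow_pos.
    - apply Nat.neq_0_lt_0, Nat.pow_nonzero. lia. }
  assert (Hb : forall n, stage_sum n - (/ 2) ^ n <= approx_sum n n / 2 ^ n <= theta).
  { intros n. pose proof (approx_sum_ge n n). pose proof (approx_sum_le_theta n n).
    pose proof (two_pow_pos n). split.
    - apply (Rle_div_r _ _ (2 ^ n)); [assumption|].
      rewrite Rmult_minus_distr_r, <- Rpow_mult_distr, Rinv_l, pow1 by lra. lra.
    - apply (Rle_div_l _ _ (2 ^ n)); [assumption|]. lra. }
  exists c. split; [intros n; eauto|split].
  - intros n y _ Hy. rewrite (Hv n y Hy). destruct (Hb n). lra.
  - intros eps He. destruct (stage_sum_lim (eps / 2) ltac:(lra)) as [t0 H0].
    destruct (pow_lt_1_zero (/ 2) ltac:(rewrite Rabs_pos_eq; lra) (eps / 2) ltac:(lra)) as [N HN].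
    exists (t0 + N)%nat. intros n y Hn _ Hy. rewrite (Hv n y Hy).
    specialize (H0 n ltac:(lia)). specialize (HN n ltac:(lia)).
    rewrite Rabs_pos_eq in HN by apply Rlt_le, half_pow_pos.
    destruct (Hb n). apply Rabs_def1; lra.
Qed.

(** * Lower bound on the complexity of the bits *)

Lemma theta_nonneg : 0 <= theta.
Proof. exact (theta_ub 0). Qed.

Lemma term_lt_len x n : 0 < T -> 2 ^ n * term T x < 4 -> (INR n - 2) * T < INR (len x).
Proof.
  intros T0 H. unfold term in H. rewrite <- Rpower_2_INR, <- Rpower_plus in H.
  replace 4 with (Rpower 2 2) in H.
  - assert (K : INR n - 2 < INR (len x) / T).
    { apply Rnot_le_lt. intros G. apply (Rlt_not_le _ _ H), Rpower_le_base2. lra. }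
    apply (Rlt_div_r _ _ T) in K; assumption.
  - replace 2 with (INR 2) at 2 by (cbn; lra). rewrite Rpower_2_INR. cbn. lra.
Qed.

(** From [n] bits of [theta] one finds a stage at which [stage_sum] exceeds [theta - 4 / 2^n];
    every compressible string not yet found then has length more than [T * (n - 2)]. *)
Lemma theta_weakly_random U tau : optimal U -> optimal V -> 0 < T <= 1 -> computable tau ->
  (forall n, INR (tau n) <= INR n * T < INR (tau n) + 3) ->
  weakly_Chaitin_random U T theta.
Proof.
  intros [PU _] [PV OV] T0 Ct Ht.
  pose proof (computable_approx_num Q_computable found_computable) as Ca.
  (* The integer part [K] is not among the bits; it is a constant built into the machine. *)
  destruct (nfloor_ex theta theta_nonneg) as [K HK].
  (* A witness holds a stage [t], the floor [v] of [2^n * theta] recovered from the bits and [K],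
     and a string of length [tau n - 2] not found at stage [t], where the approximation has reached
     [v - 2]. *)
  pose (P := fun x w => let n := len x in let t := nfst w in
    let v := nfst (nsnd w) in let y := nsnd (nsnd w) in
    (bits_code n v =? x)%nat && ((K * 2 ^ n <=? v)%nat && ((v <? S K * 2 ^ n)%nat &&
    ((v * 2 ^ (t + 2) <=? approx_num n t + 2 * 2 ^ (t + 2))%nat &&
    ((len y =? tau n - 2)%nat && negb (found y t)))))).
  assert (CP : computable2 (fun x w => Nat.b2n (P x w)))
    by (unfold P; cbv zeta; computability).
  destruct (search_code P CP) as [c0 Hc0].
  destruct (computable_nsnd _ (computable_nsnd _ computable_id)) as [cY HcY].
  set (C := cComp (cComp cY c0) U).
  (* [C] halts only where [U] does and so inherits a prefix-free domain. *)
  assert (PC : prefix_free C).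
  { intros p q [s Hs] [s' Hs'] Hpq.
    inversion Hs as [| | | |? ? ? u ? A _| | | |]; subst.
    inversion Hs' as [| | | |? ? ? u' ? A' _| | | |]; subst.
    destruct (bcode_surj u) as [r <-]. destruct (bcode_surj u') as [r' <-].
    apply PU; [now exists r|now exists r'|assumption]. }
  (* Of the constant 5, 2 comes from the length [tau n - 2] and 3 from the slack of [tau]. *)
  destruct (OV C PC) as [d Hd]. exists (d + 5)%nat. intros n Hn p Hp.
  assert (N0 : 0 <= 2 ^ n * theta)
    by (apply Rmult_le_pos; [apply Rlt_le, two_pow_pos|apply theta_nonneg]).
  destruct (nfloor_ex _ N0) as [v Hv].
  assert (Kv : (K * 2 ^ n <= v < S K * 2 ^ n)%nat).
  { pose proof (two_pow_pos n). split.
    - apply Nat.lt_succ_r, INR_lt. rewrite mult_INR, pow_2_INR, S_INR. nra.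
    - apply INR_lt. rewrite mult_INR, pow_2_INR, S_INR. nra. }
  rewrite (restr_bits _ _ _ Hv) in Hp.
  destruct (incompressible_exists V (tau n - 2) PV) as (y & Ly & Iy).
  destruct (stage_sum_lim (/ 2 ^ n)) as [t Hst]; [apply Rinv_0_lt_compat, two_pow_pos|].
  specialize (Hst t (le_n t)).
  assert (W : P (bcode (bits n v)) (npair t (npair v (bcode y))) = true).
  { unfold P. cbv zeta. rewrite nfst_npair, !nsnd_npair, nfst_npair, !len_bcode, length_bits.
    rewrite bcode_bits, Nat.eqb_refl, Ly, Nat.eqb_refl. cbn [andb].
    rewrite !andb_true_iff, negb_true_iff, !Nat.leb_le, Nat.ltb_lt.
    split; [lia|split; [lia|split]].
    - apply INR_le. rewrite plus_INR, !mult_INR, !pow_2_INR, INR_approx_num.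
      pose proof (two_pow_pos (t + 2)). pose proof (two_pow_pos n) as Pn.
      pose proof (approx_sum_ge n t).
      assert (2 ^ n * theta - 1 < 2 ^ n * stage_sum t).
      { apply (Rmult_lt_compat_l (2 ^ n)) in Hst; [|assumption].
        rewrite Rmult_minus_distr_l, Rinv_r in Hst by lra. lra. }
      cbn [INR]. nra.
    - apply not_true_is_false. intros F. apply Iy. apply comp_bcode, found_comp. eauto. }
  (* [y] and [t] only show that the search halts; whichever witness is found, its string is
     incompressible. *)
  destruct (least_witness _ _ W) as (w & Q1 & Q2).
  destruct (bcode_surj (nsnd (nsnd w))) as [s Hs].
  assert (Hrun : runs C p s).
  { unfold runs, C. eapply eComp; [exact Hp|]. eapply eComp; [apply Hc0; split; eassumption|].
    rewrite Hs. apply HcY. }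
  destruct (Hd p s Hrun) as (q & Hq & Lq).
  unfold P in Q1. cbv zeta in Q1. rewrite <- Hs, !len_bcode, length_bits in Q1.
  rewrite !andb_true_iff, negb_true_iff, !Nat.leb_le, Nat.ltb_lt, !Nat.eqb_eq in Q1.
  destruct Q1 as (E1 & E2 & E3 & E4 & E5 & E6).
  set (v' := nfst (nsnd w)) in *. set (t' := nfst w) in *.
  assert (Ev : v' = v).
  { rewrite <- bcode_bits in E1. apply bcode_inj in E1.
    assert (X : forall u, (K * 2 ^ n <= u < S K * 2 ^ n)%nat ->
      u = (val (bits n u) + K * 2 ^ n)%nat).
    { intros u Hu. replace u with ((u - K * 2 ^ n) + K * 2 ^ n)%nat at 2 by lia.
      rewrite bits_shift, val_bits; lia. }
    rewrite (X v') by lia. rewrite (X v) by lia. now rewrite E1. }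
  (* Otherwise the missing term is below 4 units of the [n]-th bit, which forces
     [|s| > (n - 2) T >= T n - 2] as [T <= 1], against [|s| = tau n - 2]. If [tau n < 2], then [s]
     is empty and has no shorter program. *)
  assert (Ns : ~ H_lt_length V s).
  { intros Hsc. apply comp_bcode in Hsc.
    pose proof (stage_sum_unfound t' (bcode s) Hsc E6) as B1.
    apply le_INR in E4. rewrite plus_INR, !mult_INR, !pow_2_INR, INR_approx_num, Ev in E4.
    cbn [INR] in E4.
    pose proof (approx_sum_le n t') as B2.
    pose proof (two_pow_pos (t' + 2)). pose proof (two_pow_pos n).
    assert (B3 : INR v - 2 <= approx_sum n t') by nra.
    assert (B4 : 2 ^ n * term T (bcode s) < 4) by nra.
    apply term_lt_len in B4; [|lra]. rewrite len_bcode, E5 in B4.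
    specialize (Ht n).
    destruct (Nat.le_gt_cases 2 (tau n)) as [G|G].
    - rewrite minus_INR in B4 by assumption. cbn [INR] in B4. nra.
    - apply comp_bcode in Hsc as (r & _ & Hr). lia. }
  assert (Lsq : (length s <= length q)%nat).
  { apply Nat.nlt_ge. intros G. apply Ns. now exists q. }
  specialize (Ht n).
  assert (Z : (tau n <= length p + d + 2)%nat) by lia.
  apply le_INR in Z. rewrite !plus_INR in *. cbn [INR] in *. nra.
Qed.

(** * Upper bound on the complexity of the bits for [T < 1] *)

Definition cap_sum (n t : nat) : R :=
  rsum t (fun x => if found x t then Rmin (qterm x n) 1 else 0).

Lemma Rmin_1_nonneg r : 0 <= r -> 0 <= Rmin r 1.
Proof. intros H. apply Rmin_glb; lra. Qed.

Lemma cap_sum_mono n t t' : (t <= t')%nat -> cap_sum n t <= cap_sum n t'.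
Proof.
  intros H. eapply Rle_trans; [|apply (rsum_mono t t')]; [| |assumption].
  - apply rsum_le. intros x _. destruct (found x t) eqn:E.
    + rewrite (found_mono _ _ _ E H). lra.
    + destruct (found x t'); [apply Rmin_1_nonneg, qterm_nonneg|lra].
  - intros x. cbv beta. destruct (found x t'); [apply Rmin_1_nonneg, qterm_nonneg|lra].
Qed.

(** [a - (a - b)] is the minimum of [a] and [b]. *)
Definition cap_num (n t : nat) : nat :=
  nsum t (fun x => if found x t
    then (Q x n * 2 ^ (t - x) - (Q x n * 2 ^ (t - x) - 2 ^ (t + 2)))%nat else 0%nat).

Lemma INR_cap_num n t : INR (cap_num n t) = cap_sum n t * 2 ^ (t + 2).
Proof.
  unfold cap_num, cap_sum. rewrite INR_nsum, (Rmult_comm _ (2 ^ (t + 2))).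
  unfold rsum. rewrite <- lsum_scal. apply lsum_ext. intros x Hx. apply in_seq in Hx.
  destruct (found x t); [|cbn; lra].
  assert (Eq : 2 ^ (t + 2) * qterm x n = INR (Q x n * 2 ^ (t - x))).
  { rewrite mult_INR, pow_2_INR. unfold qterm.
    replace (t + 2)%nat with ((t - x) + (x + 2))%nat by lia. rewrite pow_add. field.
    apply Rgt_not_eq, two_pow_pos. }
  pose proof (two_pow_pos (t + 2)) as P.
  destruct (Nat.le_gt_cases (Q x n * 2 ^ (t - x)) (2 ^ (t + 2))) as [G|G].
  - replace (_ - _)%nat with (Q x n * 2 ^ (t - x))%nat by lia.
    apply le_INR in G. rewrite <- Eq, pow_2_INR in G. rewrite Rmin_left; [now rewrite Eq|nra].
  - replace (_ - _)%nat with (2 ^ (t + 2))%nat by lia.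
    apply lt_INR in G. rewrite <- Eq, pow_2_INR in G. rewrite pow_2_INR, Rmin_right; nra.
Qed.

(** The integer part of [cap_sum], which is the computable version of [Phi_n]. *)
Definition level (n t : nat) : nat := (cap_num n t / 2 ^ (t + 2))%nat.

Lemma INR_level n t : INR (level n t) <= cap_sum n t < INR (level n t) + 1.
Proof.
  unfold level. pose proof (INR_div (cap_num n t) (2 ^ (t + 2))) as H.
  rewrite pow_2_INR, INR_cap_num in H. pose proof (two_pow_pos (t + 2)).
  replace (cap_sum n t * 2 ^ (t + 2) / 2 ^ (t + 2)) with (cap_sum n t) in H by (field; lra).
  apply H. apply Nat.neq_0_lt_0, Nat.pow_nonzero. lia.
Qed.

Lemma level_mono n t t' : (t <= t')%nat -> (level n t <= level n t')%nat.
Proof.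
  intros H. apply Nat.lt_succ_r, INR_lt. rewrite S_INR.
  pose proof (cap_sum_mono n t t' H). pose proof (INR_level n t). pose proof (INR_level n t').
  lra.
Qed.

(** Stage 0 counts as an update, so that every [n] has a request even if its level never changes. *)
Definition update (n t : nat) : bool := (t =? 0)%nat || negb (level n t =? level n (t - 1))%nat.

Lemma computable_level : computable2 level.
Proof. unfold level, cap_num. computability. Qed.

Lemma computable_update : computable2 (fun n t => Nat.b2n (update n t)).
Proof. pose proof computable_level. unfold update. computability. Qed.

(** After stage 0 every update raises the level by at least 1, since levels never decrease. *)
Lemma count_updates n N :
  rsum N (fun t => if update n t then 1 else 0) <= 1 + cap_sum n N.
Proof.
  assert (H : rsum (S N) (fun t => if update n t then 1 else 0) <= 1 + INR (level n N)).
  { induction N as [|N IH].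
    - unfold rsum, lsum. cbn -[level]. pose proof (pos_INR (level n 0)). lra.
    - rewrite rsum_S. unfold update at 2. cbn [Nat.eqb orb].
      replace (S N - 1)%nat with N by lia.
      pose proof (level_mono n N (S N) ltac:(lia)) as M.
      destruct (Nat.eqb_spec (level n (S N)) (level n N)) as [->|D]; cbn [negb]; [lra|].
      assert (D' : (S (level n N) <= level n (S N))%nat) by lia.
      apply le_INR in D'. rewrite S_INR in D'. lra. }
  rewrite rsum_S in H. pose proof (INR_level n N).
  assert (0 <= if update n N then 1 else 0) by (destruct update; lra). lra.
Qed.

Lemma cap_sum_le n t : cap_sum n t <=
  rsum t (fun x => if excluded_middle_informative (comp V x)
                   then Rmin (2 ^ n * term T x) 1 else 0).
Proof.
  apply rsum_le. intros x _.
  assert (0 <= 2 ^ n * term T x)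
    by (apply Rmult_le_pos; apply Rlt_le; [apply two_pow_pos|apply term_pos]).
  destruct (found x t) eqn:E; destruct excluded_middle_informative as [C|C].
  - apply Rle_min_compat_r, qterm_approx.
  - exfalso. apply C, found_comp. eauto.
  - now apply Rmin_1_nonneg.
  - lra.
Qed.

Lemma cap_sum_le_theta n t : cap_sum n t <= 2 ^ n * theta.
Proof.
  eapply Rle_trans; [|apply (approx_sum_le_theta n t)].
  apply rsum_le. intros x _. destruct (found x t); [apply Rmin_l|lra].
Qed.

(** While the level does not change, only strings with [qterm x n < 1] are found, and they
    contribute equally to [approx_sum] and to [cap_sum]. *)
Lemma approx_sum_stable n t t' : (t <= t')%nat -> level n t' = level n t ->
  approx_sum n t' <= approx_sum n t + 1.
Proof.
  intros Ht El.
  pose (new := fun (f : nat -> R) x => if found x t' && negb (found x t) then f x else 0).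
  assert (Split : forall f, rsum t' (fun x => if found x t' then f x else 0) =
    rsum t (fun x => if found x t then f x else 0) + rsum t' (new f)).
  { intros f. rewrite <- (rsum_extend t t' (fun x => if found x t then f x else 0)); [|assumption|].
    - unfold rsum. rewrite <- lsum_plus. apply lsum_ext. intros x _. unfold new.
      destruct (found x t) eqn:E; [rewrite (found_mono _ _ _ E Ht)|destruct (found x t')];
        cbn; lra.
    - intros i Hi. destruct (found i t) eqn:E; [|reflexivity]. apply found_lt in E. lia. }
  assert (Ncap : rsum t' (new (fun x => Rmin (qterm x n) 1)) < 1).
  { pose proof (INR_level n t) as A. pose proof (INR_level n t') as B. rewrite El in B.
    unfold cap_sum in A, B. rewrite (Split (fun x => Rmin (qterm x n) 1)) in B. lra. }
  assert (Nnn : forall x, 0 <= new (fun x => Rmin (qterm x n) 1) x).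
  { intros x. unfold new. destruct (_ && _); [apply Rmin_1_nonneg, qterm_nonneg|lra]. }
  unfold approx_sum. rewrite (Split (fun x => qterm x n)).
  apply Rplus_le_compat_l. apply Rle_trans with (2 := Rlt_le _ _ Ncap).
  apply rsum_le. intros x Hx.
  assert (Single : new (fun x => Rmin (qterm x n) 1) x < 1).
  { apply Rle_lt_trans with (2 := Ncap).
    apply Rle_trans with (rsum (S x) (new (fun x => Rmin (qterm x n) 1))).
    - rewrite rsum_S. pose proof (rsum_mono 0 x _ Nnn ltac:(lia)) as Z.
      change (rsum 0 _) with 0 in Z. lra.
    - now apply rsum_mono. }
  unfold new in *. destruct (_ && _); [|lra].
  unfold Rmin in *. destruct (Rle_dec (qterm x n) 1); lra.
Qed.

(** The levels are nondecreasing and bounded by [2^n * theta], so they reach a maximum; the first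
    stage that attains it is an update. *)
Lemma last_update n : exists t, update n t = true /\
  forall t', (t <= t')%nat -> level n t' = level n t.
Proof.
  assert (Hmax : exists t1, forall t, (level n t <= level n t1)%nat).
  { destruct (nfloor_ex (2 ^ n * theta)) as [B HB].
    { apply Rmult_le_pos; [apply Rlt_le, two_pow_pos|apply theta_nonneg]. }
    assert (Hb : forall t, (level n t <= B)%nat).
    { intros t. apply Nat.lt_succ_r, INR_lt. rewrite S_INR.
      pose proof (INR_level n t). pose proof (cap_sum_le_theta n t). lra. }
    clear HB. induction B as [|B IH].
    - exists 0%nat. intros t. specialize (Hb t). lia.
    - destruct (classic (exists t, level n t = S B)) as [[t1 E]|E].
      + exists t1. intros t. rewrite E. apply Hb.
      + apply IH. intros t. specialize (Hb t).
        assert (level n t <> S B) by (intros K; apply E; eauto). lia. }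
  destruct Hmax as [t1 H1].
  destruct (least_witness (fun t => level n t =? level n t1)%nat t1 (Nat.eqb_refl _))
    as (t & H2 & H3).
  apply Nat.eqb_eq in H2. exists t. split.
  - unfold update. destruct t as [|t]; [reflexivity|].
    replace (S t - 1)%nat with t by lia. rewrite H2, (Nat.eqb_sym (level n t1)). cbn [Nat.eqb orb].
    specialize (H3 t ltac:(lia)). cbv beta in H3. now rewrite H3.
  - intros t' Ht'. apply level_mono with (n := n) in Ht'. specialize (H1 t'). lia.
Qed.

Lemma rsum_geometric_le r N : 0 <= r < 1 -> rsum N (fun n => r ^ n) <= / (1 - r).
Proof.
  intros Hr. assert (H : rsum N (fun n => r ^ n) = (1 - r ^ N) / (1 - r)).
  { induction N as [|N IH]; [unfold rsum, lsum; cbn; field; lra|].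
    rewrite rsum_S, IH. cbn [pow]. field. lra. }
  rewrite H. unfold Rdiv. pose proof (pow_le r N (proj1 Hr)).
  assert (0 < / (1 - r)) by (apply Rinv_0_lt_compat; lra). nra.
Qed.

Lemma rsum_two_sided_geometric_le r m N : 0 < r < 1 ->
  rsum N (fun n => if (n <=? m)%nat then r ^ (m - n) else r ^ (n - S m)) <= 2 / (1 - r).
Proof.
  intros Hr.
  assert (P : 0 < / (1 - r)) by (apply Rinv_0_lt_compat; lra).
  (* Induction needs a bound that follows [N]: up to the peak an infinite geometric tail starting
     from the last summand, afterwards an exact finite sum. *)
  assert (H : rsum N (fun n => if (n <=? m)%nat then r ^ (m - n) else r ^ (n - S m)) <=
    if (N <=? m)%nat then r ^ (S m - N) / (1 - r)
    else / (1 - r) + (1 - r ^ (N - S m)) / (1 - r)).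
  { induction N as [|N IH].
    - unfold rsum, lsum. cbn [seq map fold_right Nat.leb]. apply Rmult_le_pos; [|lra].
      apply pow_le; lra.
    - rewrite rsum_S.
      destruct (Nat.leb_spec N m) as [G|G]; destruct (Nat.leb_spec (S N) m) as [G'|G']; try lia.
      + replace (S m - N)%nat with (S (m - N)) in IH by lia.
        replace (S m - S N)%nat with (m - N)%nat by lia.
        replace (r ^ (m - N) / (1 - r)) with (r ^ S (m - N) / (1 - r) + r ^ (m - N)); [lra|].
        cbn [pow]. field. lra.
      + replace N with m in * by lia. rewrite !Nat.sub_diag in *.
        replace (S m - m)%nat with 1%nat in IH by lia. cbn [pow] in *.
        replace (/ (1 - r)) with (r * 1 / (1 - r) + 1) by (field; lra). lra.
      + replace (S N - S m)%nat with (S (N - S m)) by lia. cbn [pow].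
        replace (/ (1 - r) + (1 - r * r ^ (N - S m)) / (1 - r))
          with (/ (1 - r) + (1 - r ^ (N - S m)) / (1 - r) + r ^ (N - S m)) by (field; lra).
        lra. }
  eapply Rle_trans; [exact H|]. unfold Rdiv.
  destruct (N <=? m)%nat.
  - assert (r ^ (S m - N) <= 1) by (rewrite <- (pow1 (S m - N)); apply pow_incr; lra). nra.
  - assert (0 <= r ^ (N - S m)) by (apply pow_le; lra). nra.
Qed.

(** With [u = |s| / T], so that [2^(-T u) = 2^-|s|], the product is at most [2^-|s|] times
    [2^(-(1 - T)(u - n))] for [n <= u], and times [2^(-T (n - u))] for [n > u]. The slower rate [e]
    serves both sides. *)
Lemma cap_weight_le : 0 < T < 1 -> exists C, 0 <= C /\ forall x M,
  rsum M (fun n => Rpower 2 (- INR n * T) * Rmin (2 ^ n * term T x) 1) <= C * (/ 2) ^ len x.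
Proof.
  intros HT. set (e := Rmin T (1 - T)).
  assert (He : 0 < e) by (apply Rmin_pos; lra).
  assert (He1 : e <= T) by apply Rmin_l. assert (He2 : e <= 1 - T) by apply Rmin_r.
  set (r := Rpower 2 (- e)).
  assert (Hr : 0 < r < 1).
  { split; [apply Rpower_pos|]. unfold r. rewrite <- (Rpower_O 2) by lra.
    apply Rpower_lt; lra. }
  exists (2 / (1 - r)). split.
  { apply Rmult_le_pos; [lra|]. apply Rlt_le, Rinv_0_lt_compat. lra. }
  intros x M. set (k := len x).
  assert (Hk : 0 <= INR k / T)
    by (apply Rmult_le_pos; [apply pos_INR|apply Rlt_le, Rinv_0_lt_compat; lra]).
  destruct (nfloor_ex _ Hk) as [m Hm].
  rewrite (Rmult_comm (2 / (1 - r))).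
  apply Rle_trans with (rsum M (fun n => (/ 2) ^ k *
    (if (n <=? m)%nat then r ^ (m - n) else r ^ (n - S m)))).
  - apply rsum_le. intros n _.
    unfold term. fold k. rewrite <- Rpower_2_INR, <- Rpower_plus.
    replace (- INR k / T) with (- (INR k / T)) by (unfold Rdiv; ring).
    set (u := INR k / T) in *.
    assert (Eh : (/ 2) ^ k = Rpower 2 (- u * T)).
    { rewrite pow_inv, <- Rpower_2_INR, <- Rpower_Ropp. f_equal. unfold u. field. lra. }
    rewrite Eh. clear Eh.
    assert (Er : forall j, r ^ j = Rpower 2 (- e * INR j)).
    { intros j. rewrite <- Rpower_pow by apply Rpower_pos. apply Rpower_mult. }
    pose proof (Rpower_pos 2 (- INR n * T)) as P.
    destruct (Nat.leb_spec n m) as [G|G]; rewrite Er, <- Rpower_plus.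
    + apply Rle_trans with (Rpower 2 (- INR n * T) * Rpower 2 (INR n + - u)).
      { apply Rmult_le_compat_l; [lra|apply Rmin_l]. }
      rewrite <- Rpower_plus. apply Rpower_le_base2. rewrite minus_INR by assumption.
      apply le_INR in G. nra.
    + apply Rle_trans with (Rpower 2 (- INR n * T) * 1).
      { apply Rmult_le_compat_l; [lra|apply Rmin_r]. }
      rewrite Rmult_1_r. apply Rpower_le_base2. rewrite minus_INR by assumption.
      apply le_INR in G. rewrite S_INR in *. nra.
  - unfold rsum. rewrite lsum_scal. apply Rmult_le_compat_l; [apply Rlt_le, half_pow_pos|].
    now apply rsum_two_sided_geometric_le.
Qed.

Lemma rsum_swap N M (f : nat -> nat -> R) :
  rsum N (fun a => rsum M (f a)) = rsum M (fun b => rsum N (fun a => f a b)).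
Proof. apply lsum_swap. Qed.

(** The 3 lifts [tau n] above [T n] and keeps the length nonzero, since 0 means no request; [c]
    scales the total weight below 1. *)
Definition update_length (tau : nat -> nat) (c i : nat) : nat :=
  if update (nfst i) (nsnd i) then (tau (nfst i) + 3 + c)%nat else 0%nat.

Lemma update_weight_le tau : prefix_free V -> 0 < T < 1 ->
  (forall n, INR (tau n) <= INR n * T < INR (tau n) + 3) ->
  exists c, forall N, rsum N (weight (update_length tau c)) <= 1.
Proof.
  intros PV HT Ht.
  destruct (cap_weight_le HT) as (C & C0 & HC).
  set (r := Rpower 2 (- T)).
  assert (Hr : 0 < r < 1).
  { split; [apply Rpower_pos|]. unfold r. rewrite <- (Rpower_O 2) by lra.
    apply Rpower_lt; lra. }
  destruct (Pow_x_infinity 2 ltac:(rewrite Rabs_pos_eq; lra) (/ (1 - r) + C)) as [c Hc].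
  specialize (Hc c (le_n c)). rewrite Rabs_pos_eq in Hc by apply Rlt_le, two_pow_pos.
  exists c. intros N.
  apply Rle_trans with ((/ 2) ^ c * (/ (1 - r) + C)).
  2: { rewrite pow_inv. pose proof (two_pow_pos c).
       apply (Rmult_le_reg_l (2 ^ c)); [assumption|]. rewrite <- Rmult_assoc, Rinv_r by lra. lra. }
  pose (g := fun n t => (/ 2) ^ c * (Rpower 2 (- INR n * T) * if update n t then 1 else 0)).
  apply Rle_trans with (rsum N (fun i => g (nfst i) (nsnd i))).
  { apply rsum_le. intros i _. unfold weight, update_length, g.
    generalize (nfst i) (nsnd i). intros n t.
    destruct (update n t); [|cbn; pose proof (half_pow_pos c); lra].
    destruct (Nat.eqb_spec (tau n + 3 + c) 0) as [|_]; [lia|].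
    rewrite pow_add, Rmult_comm, Rmult_1_r.
    apply Rmult_le_compat_l; [apply Rlt_le, half_pow_pos|].
    rewrite pow_inv, <- Rpower_2_INR, <- Rpower_Ropp. apply Rpower_le_base2.
    rewrite plus_INR. cbn [INR]. specialize (Ht n). lra. }
  eapply Rle_trans.
  { apply rsum_npair_le. intros n t. unfold g. pose proof (half_pow_pos c).
    pose proof (Rpower_pos 2 (- INR n * T)).
    destruct (update n t); [|rewrite Rmult_0_r, Rmult_0_r; lra].
    apply Rmult_le_pos; lra. }
  pose (cw := fun n x => if excluded_middle_informative (comp V x)
                   then Rmin (2 ^ n * term T x) 1 else 0).
  apply Rle_trans with (rsum N (fun n => (/ 2) ^ c *
    (r ^ n + rsum N (fun x => Rpower 2 (- INR n * T) * cw n x)))).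
  { apply rsum_le. intros n _. unfold g, rsum. rewrite lsum_scal.
    apply Rmult_le_compat_l; [apply Rlt_le, half_pow_pos|].
    rewrite !lsum_scal.
    replace (r ^ n) with (Rpower 2 (- INR n * T) * 1).
    - rewrite <- Rmult_plus_distr_l. apply Rmult_le_compat_l; [apply Rlt_le, Rpower_pos|].
      eapply Rle_trans; [apply (count_updates n N)|].
      apply Rplus_le_compat_l, cap_sum_le.
    - unfold r. rewrite <- Rpower_pow, Rpower_mult by apply Rpower_pos.
      rewrite Rmult_1_r. f_equal. ring. }
  unfold rsum at 1. rewrite lsum_scal. apply Rmult_le_compat_l; [apply Rlt_le, half_pow_pos|].
  rewrite lsum_plus. apply Rplus_le_compat; [apply rsum_geometric_le; lra|].
  change (rsum N (fun n => rsum N (fun x => Rpower 2 (- INR n * T) * cw n x)) <= C).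
  (* For a fixed string the sum over [n] is bounded by [cap_weight_le]; the sum over strings is then
     bounded by Kraft's inequality. *)
  rewrite rsum_swap.
  apply Rle_trans with (rsum N (fun x => C *
    if excluded_middle_informative (comp V x) then (/ 2) ^ len x else 0)).
  - apply rsum_le. intros x _. unfold cw. destruct excluded_middle_informative; [apply HC|].
    rewrite Rmult_0_r. apply Req_le, rsum_eq_0. intros; lra.
  - unfold rsum. rewrite lsum_scal. rewrite <- (Rmult_1_r C) at 2.
    apply Rmult_le_compat_l; [assumption|]. now apply rsum_half_len_le.
Qed.

(** The offset [j] corrects the floor of [approx_sum]. Its right value depends on [n] and need not
    be computed, because each offset gets its own list of requests. *)
Definition update_payload (j i : nat) : nat :=
  bits_code (nfst i) (approx_num (nfst i) (nsnd i) / 2 ^ (nsnd i + 2) + j).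

(** At the last update [t] for [n], [2^n * theta] exceeds [approx_sum n t] by at most [2]. *)
Lemma restr_theta_update n : exists t j, update n t = true /\ (j < 3)%nat /\
  bcode (restr theta n) = update_payload j (npair n t).
Proof.
  destruct (last_update n) as (t & Ut & Lt). exists t.
  assert (N0 : 0 <= 2 ^ n * theta)
    by (apply Rmult_le_pos; [apply Rlt_le, two_pow_pos|apply theta_nonneg]).
  destruct (nfloor_ex _ N0) as [v Hv].
  set (v0 := (approx_num n t / 2 ^ (t + 2))%nat).
  assert (Hv0 : INR v0 <= approx_sum n t < INR v0 + 1).
  { pose proof (INR_div (approx_num n t) (2 ^ (t + 2))) as H.
    rewrite pow_2_INR, INR_approx_num in H. pose proof (two_pow_pos (t + 2)).
    replace (approx_sum n t * 2 ^ (t + 2) / 2 ^ (t + 2)) with (approx_sum n t) in H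
      by (field; lra).
    apply H. apply Nat.neq_0_lt_0, Nat.pow_nonzero. lia. }
  (* One unit covers what is found after [t] ([approx_sum_stable]), the other the rounding of the
     terms ([approx_sum_ge]). *)
  assert (Hup : 2 ^ n * theta <= approx_sum n t + 2).
  { apply Rnot_lt_le. intros G. pose proof (two_pow_pos n) as Pn.
    destruct (stage_sum_lim ((2 ^ n * theta - (approx_sum n t + 2)) / 2 ^ n)) as [t0 H0].
    { apply Rmult_lt_0_compat; [lra|now apply Rinv_0_lt_compat]. }
    set (t' := (t + t0)%nat). specialize (H0 t' ltac:(lia)).
    apply (Rmult_lt_compat_l (2 ^ n)) in H0; [|assumption].
    replace (2 ^ n * (theta - (2 ^ n * theta - (approx_sum n t + 2)) / 2 ^ n))
      with (approx_sum n t + 2) in H0 by (field; lra).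
    pose proof (approx_sum_ge n t').
    pose proof (approx_sum_stable n t t' ltac:(lia) (Lt t' ltac:(lia))). lra. }
  pose proof (approx_sum_le_theta n t) as Hlo.
  exists (v - v0)%nat. split; [assumption|].
  assert (B1 : (v0 < S v)%nat) by (apply INR_lt; rewrite S_INR; lra).
  assert (B2 : (v < v0 + 3)%nat) by (apply INR_lt; rewrite plus_INR; cbn [INR]; lra).
  split; [lia|].
  unfold update_payload. rewrite nfst_npair, nsnd_npair. fold v0.
  replace (v0 + (v - v0))%nat with v by lia.
  rewrite <- bcode_bits. f_equal. now apply restr_bits.
Qed.

Lemma theta_strictly_compressible U tau : optimal U -> prefix_free V -> 0 < T < 1 ->
  computable tau -> (forall n, INR (tau n) <= INR n * T < INR (tau n) + 3) ->
  strictly_compressible U T theta.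
Proof.
  intros OU PV HT Ct Ht.
  destruct (update_weight_le tau PV HT Ht) as [c Hc].
  pose proof computable_update as Cu.
  pose proof (computable_approx_num Q_computable found_computable) as Ca.
  assert (CL : computable (update_length tau c)) by (unfold update_length; computability).
  assert (HD : forall j, exists d, forall i s, update_length tau c i <> 0%nat ->
    bcode s = update_payload j i ->
    exists p, runs U p s /\ (length p <= update_length tau c i + d)%nat).
  { intros j. apply request_complexity; [assumption|assumption| |assumption].
    unfold update_payload. computability. }
  destruct (HD 0%nat) as [d0 H0]. destruct (HD 1%nat) as [d1 H1]. destruct (HD 2%nat) as [d2 H2].
  exists (3 + c + (d0 + d1 + d2))%nat. intros n _.
  destruct (restr_theta_update n) as (t & j & Ut & Hj & Hs).
  assert (EL : update_length tau c (npair n t) = (tau n + 3 + c)%nat).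
  { unfold update_length. now rewrite nfst_npair, nsnd_npair, Ut. }
  assert (Hp : exists p, runs U p (restr theta n) /\
    (length p <= tau n + (3 + c + (d0 + d1 + d2)))%nat).
  { destruct j as [|[|[|j]]]; [| | |lia];
      [destruct (H0 (npair n t) _ ltac:(lia) Hs) as (p & Hp & Lp)
      |destruct (H1 (npair n t) _ ltac:(lia) Hs) as (p & Hp & Lp)
      |destruct (H2 (npair n t) _ ltac:(lia) Hs) as (p & Hp & Lp)];
      exists p; (split; [assumption|lia]). }
  destruct Hp as (p & Hp & Lp). exists p. split; [assumption|].
  apply le_INR in Lp. rewrite plus_INR in Lp. specialize (Ht n). lra.
Qed.

End Enumeration.

(** * Divergence above temperature one *)

Lemma rsum_const_below N B c : 0 <= c ->
  rsum N (fun r => if (r <? B)%nat then c else 0) <= INR B * c.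
Proof.
  intros Hc. assert (E : rsum N (fun r => if (r <? B)%nat then c else 0) = INR (Nat.min N B) * c).
  { induction N as [|N IH]; [unfold rsum, lsum; cbn; lra|].
    rewrite rsum_S, IH. destruct (Nat.ltb_spec N B).
    - replace (Nat.min (S N) B) with (S (Nat.min N B)) by lia. rewrite S_INR. lra.
    - replace (Nat.min (S N) B) with (Nat.min N B) by lia. lra. }
  rewrite E. apply Rmult_le_compat_r; [assumption|]. apply le_INR. lia.
Qed.

(** A string of length [(k + 2) m] starting with [2 m] zeros gets a program of length
    about [(k + 1) m]. *)
Lemma padded_compressible V k : optimal V -> exists m0, forall m r,
  (m0 <= m)%nat -> (r < 2 ^ (k * m))%nat -> H_lt_length V (bits ((k + 2) * m) r).
Proof.
  intros OV.
  pose (L := fun i => if (nsnd i <? 2 ^ (k * nfst i))%nat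
                      then ((k + 1) * nfst i + 1)%nat else 0%nat).
  pose (Y := fun i => bits_code ((k + 2) * nfst i) (nsnd i)).
  destruct (request_complexity L Y V OV) as [d Hd].
  - unfold L. computability.
  - unfold Y. computability.
  (* For each [m] the [2^(k m)] requests together weigh [2^-(m + 1)], and these weights sum to at
     most 1. *)
  - intros N.
    pose (g := fun m r => if (r <? 2 ^ (k * m))%nat then (/ 2) ^ ((k + 1) * m + 1) else 0).
    apply Rle_trans with (rsum N (fun i => g (nfst i) (nsnd i))).
    { apply rsum_le. intros i _. unfold weight, L, g.
      destruct (nsnd i <? 2 ^ (k * nfst i))%nat; [|cbn; lra].
      destruct (Nat.eqb_spec ((k + 1) * nfst i + 1) 0); [lia|lra]. }
    eapply Rle_trans; [apply rsum_npair_le|].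
    { intros m r. unfold g. destruct (r <? _)%nat; [apply Rlt_le, half_pow_pos|lra]. }
    apply Rle_trans with (rsum N (fun m => / 2 * (/ 2) ^ m)).
    + apply rsum_le. intros m _.
      eapply Rle_trans; [apply rsum_const_below, Rlt_le, half_pow_pos|].
      replace ((k + 1) * m + 1)%nat with (k * m + (m + 1))%nat by lia.
      rewrite pow_2_INR, pow_add, <- Rmult_assoc, <- Rpow_mult_distr, Rinv_r, pow1 by lra.
      rewrite pow_add. lra.
    + rewrite rsum_half_pow. pose proof (half_pow_pos N). lra.
  (* The program length [(k + 1) m + 1 + d] is below [(k + 2) m] once [m >= d + 2]. *)
  - exists (d + 2)%nat. intros m r Hm Hr.
    assert (EL : L (npair m r) = ((k + 1) * m + 1)%nat).
    { unfold L. rewrite nfst_npair, nsnd_npair. apply Nat.ltb_lt in Hr. now rewrite Hr. }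
    destruct (Hd (npair m r) (bits ((k + 2) * m) r)) as (p & Hp & Lp).
    + lia.
    + unfold Y. rewrite nfst_npair, nsnd_npair. apply bcode_bits.
    + exists p. split; [assumption|]. rewrite length_bits. lia.
Qed.

(** The length is [(k + 2) m <= k m T], so each of the [2^(k m)] terms is at least [2^(-k m)]. *)
Lemma theta_level_ge_1 V T k m : 0 < T -> INR k + 2 <= INR k * T ->
  (forall r, (r < 2 ^ (k * m))%nat -> H_lt_length V (bits ((k + 2) * m) r)) ->
  1 <= lsum (theta_term V T) (all_strings ((k + 2) * m)).
Proof.
  intros T0 Hk H. set (n := ((k + 2) * m)%nat) in *.
  apply Rle_trans with (lsum (theta_term V T) (map (bits n) (seq 0 (2 ^ (k * m))))).
  - rewrite lsum_map, (lsum_ext _ (fun _ => Rpower 2 (- INR n / T))).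
    + rewrite lsum_const, length_seq, pow_2_INR, <- Rpower_2_INR, <- Rpower_plus.
      rewrite <- (Rpower_O 2) at 1 by lra. apply Rpower_le_base2.
      unfold n. rewrite !mult_INR, plus_INR. cbn [INR]. pose proof (pos_INR m) as M0.
      assert (G : (INR k + (1 + 1)) * INR m / T <= INR k * INR m)
        by (apply (Rle_div_l _ _ T); [assumption|nra]).
      unfold Rdiv in *. lra.
    + intros r Hr. apply in_seq in Hr. unfold theta_term. rewrite length_bits.
      destruct excluded_middle_informative as [|K]; [reflexivity|].
      exfalso. apply K, H. lia.
  - apply lsum_incl; [| |intros; apply theta_term_nonneg].
    + apply NoDup_map_bits. apply Nat.pow_le_mono_r; unfold n; nia.
    + intros s Hs. apply in_map_iff in Hs as (r & <- & _). apply in_all_strings, length_bits.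
Qed.

Lemma theta_diverges V T : optimal V -> 1 < T -> is_lim_seq (theta_partial V T) p_infty.
Proof.
  intros OV HT.
  (* [k] is so large that the two extra blocks of zeros cost less than the gain from [T > 1]:
     [k + 2 <= k T]. *)
  destruct (INR_unbounded (2 / (T - 1))) as [k Hk].
  assert (Hk' : INR k + 2 <= INR k * T).
  { apply (Rlt_div_l 2 (INR k) (T - 1)) in Hk; lra. }
  destruct (padded_compressible V k OV) as [m0 Hm].
  assert (H : forall j, INR j <= theta_partial V T (S ((k + 2) * (m0 + j)))).
  { induction j as [|j IH].
    - apply (Rle_trans _ (theta_partial V T 0)); [unfold theta_partial; cbn; lra|].
      apply theta_partial_mono. lia.
    - rewrite theta_partial_S, S_INR.
      pose proof (theta_partial_mono V T (S ((k + 2) * (m0 + j)))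
        ((k + 2) * (m0 + S j)) ltac:(nia)).
      pose proof (theta_level_ge_1 V T k (m0 + S j) ltac:(lra) Hk'
        (fun r => Hm (m0 + S j)%nat r ltac:(lia))). lra. }
  apply is_lim_seq_spec. intros M. destruct (INR_unbounded M) as [j Hj].
  exists (S ((k + 2) * (m0 + j))). intros n Hn.
  pose proof (theta_partial_mono V T _ _ Hn). specialize (H j). lra.
Qed.

Theorem theorem7 (U V : code) (T : R) :
  optimal U -> optimal V -> 0 < T ->
  ((computable_real T -> T <= 1 ->
      exists theta : R, is_lim_seq (theta_partial V T) (Finite theta) /\
        left_computable theta /\ weakly_Chaitin_random U T theta) /\
   (computable_real T -> T < 1 ->
      exists theta : R, is_lim_seq (theta_partial V T) (Finite theta) /\
        strictly_compressible U T theta) /\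
   (1 < T -> is_lim_seq (theta_partial V T) p_infty)).
Proof.
  intros OU OV T0. split; [|split].
  - intros CT T1.
    destruct (theta_converges V T (proj1 OV) (conj T0 T1)) as (theta & HL & Hub & Hlub).
    destruct (H_lt_length_enumerable V) as (found & Cf & Fm & Fl & Fc).
    destruct (computable_term T CT T0) as (Q & CQ & HQ).
    destruct (computable_multiples T CT T0) as (tau & Ct & Ht).
    exists theta. split; [assumption|split].
    + eapply theta_left_computable; eassumption.
    + eapply theta_weakly_random; eauto.
  - intros CT T1.
    destruct (theta_converges V T (proj1 OV) (conj T0 (Rlt_le _ _ T1)))
      as (theta & HL & Hub & Hlub).
    destruct (H_lt_length_enumerable V) as (found & Cf & Fm & Fl & Fc).
    destruct (computable_term T CT T0) as (Q & CQ & HQ).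
    destruct (computable_multiples T CT T0) as (tau & Ct & Ht).
    exists theta. split; [assumption|].
    eapply theta_strictly_compressible; eauto. apply OV.
  - intros T1. now apply theta_diverges.
Qed.
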